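(* Let $G$ be a spatial partition quantum group, and let $\mathcal C\subseteq\mathcal P^{(m)}$ be an $\boldsymbol n$-graded rigid category of spatial partitions corresponding to $G$. Then the projective version $PG$ is again a spatial partition quantum group. Moreover, $PG$ corresponds to the category of spatial partitions $\mathrm{Flat}_{m,\circ\bullet}^{-1}(\mathcal C)=\{p\in\mathcal P^{(2m)}:\mathrm{Flat}_{m,\circ\bullet}(p)\in\mathcal C\}$.
   Context: Colours: $\{\circ,\bullet\}^*$ is the free monoid of finite words in two colours with empty word $1$; $|x|$ is the length and $x_i$ the $i$-th letter of $x$; $x\mapsto\overline x$ is the anti-homomorphism with $\overline\circ=\bullet$, $\overline\bullet=\circ$. Spatial partitions: for $m\ge1$, $\mathcal P^{(m)}(x,y)$ is the set of set partitions (into blocks) of $\{1,\dots,|x|+|y|\}\times\{1,\dots,m\}$; points $(i,j)$ with $i\le|x|$ are upper points of colour $x_i$, points $(|x|+i,j)$ are lower points of colour $y_i$, and $j$ is the level. $\mathcal P^{(m)}=\bigcup_{x,y}\mathcal P^{(m)}(x,y)$. Tensor product $p\otimes q\in\mathcal P^{(m)}(xw,yz)$ of $p\in\mathcal P^{(m)}(x,y)$, $q\in\mathcal P^{(m)}(w,z)$: place $q$ to the right of $p$. Involution $p^*\in\mathcal P^{(m)}(y,x)$: swap upper and lower points. Composition $pq\in\mathcal P^{(m)}(x,z)$ of $p\in\mathcal P^{(m)}(y,z)$, $q\in\mathcal P^{(m)}(x,y)$: identify each lower point of $q$ with the corresponding upper point of $p$, merge blocks sharing identified points, delete the identified points and any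 resulting empty blocks. $\mathrm{id}_x\in\mathcal P^{(m)}(x,x)$ has blocks $\{(i,j),(|x|+i,j)\}$. A category of spatial partitions on $m$ levels is a subset $\mathcal C\subseteq\mathcal P^{(m)}$ closed under composition, tensor product and involution and containing $\mathrm{id}_\circ,\mathrm{id}_\bullet$; $\mathcal C(x,y)=\mathcal C\cap\mathcal P^{(m)}(x,y)$. It is rigid if there are $r\in\mathcal C(1,\circ\bullet)$, $s\in\mathcal C(1,\bullet\circ)$ with $(r^*\otimes\mathrm{id}_\circ)(\mathrm{id}_\circ\otimes s)=\mathrm{id}_\circ$ and $(s^*\otimes\mathrm{id}_\bullet)(\mathrm{id}_\bullet\otimes r)=\mathrm{id}_\bullet$. For $\boldsymbol n=(n_1,\dots,n_m)\in\mathbb N^m$, $p$ is $\boldsymbol n$-graded if $n_k=n_\ell$ whenever points $(i,k),(j,\ell)$ lie in one block; $\mathcal C$ is $\boldsymbol n$-graded if all its elements are. Flattening: for $m\ge1$ and $z\in\{\circ,\bullet\}^*$ with $d=|z|\ge1$, $\mathrm{Flat}_{m,z}:\mathcal P^{(md)}\to\mathcal P^{(m)}$ acts on words as the monoid homomorphism with $\circ\mapsto z$, $\bullet\mapsto\overline z$, and sends $p\in\mathcal P^{(md)}(x,y)$ to the partition in $\mathcal P^{(m)}(\mathrm{Flat}_{m,z}(x),\mathrm{Flat}_{m,z}(y))$ whose blocks are the images of the blocks of $p$ under the bijection $\{1,\dots,|x|+|y|\}\times\{1,\dots,md\}\to\{1,\dots,(|x|+|y|)d\}\times\{1,\dots,m\}$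 given, for $1\le j\le m$, $0\le c<d$, by $(i,j+cm)\mapsto((i-1)d+c+1,j)$ if $(xy)_i=\circ$ and $(i,j+cm)\mapsto(id-c,j)$ if $(xy)_i=\bullet$. Quantum groups: for a finite-dimensional Hilbert space $V$ with conjugate $\overline V$, put $V^\circ=V$, $V^\bullet=\overline V$, $V^{\otimes x}=V^{x_1}\otimes\cdots\otimes V^{x_{|x|}}$ ($\mathbb C$ if $x=1$); for an operator $T$, $\overline T(\overline v)=\overline{T(v)}$, $T^\circ=T$, $T^\bullet=\overline T$, $T^{\otimes x}=T^{x_1}\otimes\cdots\otimes T^{x_{|x|}}$. Elements $u\in B(V)\otimes A$ ($A$ a unital $C^*$-algebra) are $A$-valued matrices $(u^i_j)$ in an orthonormal basis; $\overline u\in B(\overline V)\otimes A$ has entries $(u^i_j)^*$; $u\top v$ on $V\otimes W$ has entries $u^{i_1}_{j_1}v^{i_2}_{j_2}$. A compact matrix quantum group is $G=(C(G),u)$ with $C(G)$ a unital $C^*$-algebra generated by the entries of $u\in B(V)\otimes C(G)$, $u$ unitary, $\overline u$ invertible, and a $*$-homomorphism $\Delta:C(G)\to C(G)\otimes C(G)$ with $\Delta(u^i_j)=\sum_k u^i_k\otimes u^k_j$. A representation is an invertible $v\in B(W)\otimes C(G)$ with $\Delta(v^i_j)=\sum_k v^i_k\otimes v^k_j$; $\mathrm{Hom}(v,w)=\{T: Tv=wT\}$. Given $u^\circ=u$ and a unitary representation $u^\bullet$ on $\overline V$, $u^x=u^{x_1}\top\cdots\top u^{x_{|x|}}$, $u^1=1$.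 Linear maps: $[\boldsymbol n]=\prod_k\{1,\dots,n_k\}$, $\mathbb C^{\boldsymbol n}=\mathbb C^{n_1}\otimes\cdots\otimes\mathbb C^{n_m}$ with basis $e_{\boldsymbol i}$, $\boldsymbol i\in[\boldsymbol n]$. For $\boldsymbol n$-graded $p\in\mathcal P^{(m)}(x,y)$, $T_p^{(\boldsymbol n)}:(\mathbb C^{\boldsymbol n})^{\otimes x}\to(\mathbb C^{\boldsymbol n})^{\otimes y}$ has, in the canonical bases, matrix coefficient (input $\boldsymbol j_1,\dots,\boldsymbol j_{|x|}$, output $\boldsymbol i_1,\dots,\boldsymbol i_{|y|}$) equal to $1$ if, labelling upper point $(k,\ell)$ by the $\ell$-th entry of $\boldsymbol j_k$ and lower point $(|x|+k,\ell)$ by the $\ell$-th entry of $\boldsymbol i_k$, labels are constant on every block, and $0$ otherwise. A compact matrix quantum group $G$ with fundamental representation $u^\circ$ on $V$ is a spatial partition quantum group corresponding to an $\boldsymbol n$-graded rigid category $\mathcal C\subseteq\mathcal P^{(m)}$ (some $m\ge 1$, $\boldsymbol n\in\mathbb N^m$) if there are a unitary representation $u^\bullet$ on $\overline V$ and a unitary $Q:\mathbb C^{\boldsymbol n}\to V$ with $\mathrm{Hom}(u^x,u^y)=\mathrm{span}\{Q^{\otimes y}T_p^{(\boldsymbol n)}(Q^{-1})^{\otimes x}:p\in\mathcal C(x,y)\}$ for all $x,y\in\{\circ,\bullet\}^*$. For $\mathrm{Flat}_{m,\circ\bullet}^{-1}(\mathcal C)\subseteq\mathcal P^{(2m)}$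 the grading used is $(n_1,\dots,n_m,n_1,\dots,n_m)$. Projective version: if $G$ has fundamental representation $u$ with $\overline u$ unitary (which holds for every spatial partition quantum group), $PG=(A,u\top\overline u)$ where $A\subseteq C(G)$ is the $C^*$-subalgebra generated by the entries of $u\top\overline u$. *)

(* Defs.v *)
From HB Require Import structures.
From mathcomp Require Import all_boot.

Set Implicit Arguments.
Unset Strict Implicit.
Unset Printing Implicit Defensive.

(** * Coloured words *)

Variant colour := White | Black.

Definition flip (c : colour) : colour :=
  match c with White => Black | Black => White end.

Definition word := seq colour.

Definition letter (x : word) (i : 'I_(size x)) : colour := tnth (in_tuple x) i.

Definition word_bar (x : word) : word := rev (map flip x).

Definition flat_word (z x : word) : word :=
  flatten [seq match c with White => z | Black => word_bar z end | c <- x].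

(** * Spatial partitions *)

(* [inl i] is the i-th upper position and [inr i] the i-th lower one, i.e. the
   position |x| + i of {1, ..., |x| + |y|}; indices and levels start at 0. *)
Definition leg (x y : word) : finType := ('I_(size x) + 'I_(size y))%type.

Definition leg_colour x y (a : leg x y) : colour :=
  match a with inl i => letter i | inr i => letter i end.

Definition sp_point (m : nat) (x y : word) : finType := (leg x y * 'I_m)%type.

Record spart (m : nat) (x y : word) := SPart {
  blocks :> {set {set sp_point m x y}};
  blocksP : partition blocks [set: sp_point m x y]
}.

Lemma partition_setT (T : finType) (P : {set {set T}}) :
  set0 \notin P -> (forall a, exists2 B, B \in P & a \in B) ->
  (forall a B1 B2, B1 \in P -> B2 \in P -> a \in B1 -> a \in B2 -> B1 = B2) ->
  partition P [set: T].
Proof.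
move=> P0 Pcov Puniq; apply/and3P; split=> //.
  apply/eqP/setP => a; rewrite inE; have [B BP aB] := Pcov a.
  by apply/bigcupP; exists B.
apply/trivIsetP => B1 B2 B1P B2P; apply: contraR => /pred0Pn[a /andP[a1 a2]].
by apply/eqP; exact: (Puniq a).
Qed.

Lemma partition_bij (T T' : finType) (f : T -> T') (P : {set {set T}}) :
  bijective f -> partition P [set: T] ->
  partition [set [set f a | a in B] | B : {set T} in P] [set: T'].
Proof.
move=> fbij PT; have finj := bij_inj fbij.
have -> : [set: T'] = f @: [set: T].
  by apply/setP => b; have [g fK gK] := fbij; rewrite inE -(gK b) imset_f.
by rewrite imset_partition //; exact: in2W.
Qed.

Definition leg_swap x y (a : leg x y) : leg y x :=
  match a with inl i => inr i | inr i => inl i end.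

Lemma leg_swap_bij m x y :
  bijective (fun a : sp_point m x y => (leg_swap a.1, a.2) : sp_point m y x).
Proof.
by exists (fun a : sp_point m y x => (leg_swap a.1, a.2)) => -[[i|i] l].
Qed.

Definition sp_star m x y (p : spart m x y) : spart m y x :=
  SPart (partition_bij (@leg_swap_bij m x y) (blocksP p)).

Section Tensor.
Variables (m : nat) (x y w z : word).

Definition ord_left (s t : word) (i : 'I_(size s)) : 'I_(size (s ++ t)) :=
  cast_ord (esym (size_cat s t)) (lshift (size t) i).

Definition ord_right (s t : word) (i : 'I_(size t)) : 'I_(size (s ++ t)) :=
  cast_ord (esym (size_cat s t)) (rshift (size s) i).

Definition leg_left (a : leg x y) : leg (x ++ w) (y ++ z) :=
  match a with inl i => inl (ord_left w i) | inr i => inr (ord_left z i) end.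

Definition leg_right (a : leg w z) : leg (x ++ w) (y ++ z) :=
  match a with inl i => inl (ord_right x i) | inr i => inr (ord_right y i) end.

Definition sp_tensor_blocks (p : spart m x y) (q : spart m w z) :
    {set {set sp_point m (x ++ w) (y ++ z)}} :=
  [set [set (leg_left a.1, a.2) | a in B] | B : {set sp_point m x y} in blocks p]
  :|: [set [set (leg_right a.1, a.2) | a in B] | B : {set sp_point m w z} in blocks q].

Let fl (a : sp_point m x y) : sp_point m (x ++ w) (y ++ z) := (leg_left a.1, a.2).
Let fr (a : sp_point m w z) : sp_point m (x ++ w) (y ++ z) := (leg_right a.1, a.2).

Lemma ord_split (s t : word) (i : 'I_(size (s ++ t))) :
  (exists j, i = ord_left t j) \/ (exists j, i = ord_right s j).
Proof.
have -> : i = cast_ord (esym (size_cat s t)) (cast_ord (size_cat s t) i).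
  by apply: val_inj.
case: (splitP (cast_ord (size_cat s t) i)) => j e; [left|right]; exists j;
  by apply: val_inj => /=; rewrite -[RHS]e.
Qed.

Let fl_inj : injective fl.
Proof.
by move=> [[i|i] k] [[j|j] l] // [] /val_inj -> ->.
Qed.

Let fr_inj : injective fr.
Proof.
by move=> [[i|i] k] [[j|j] l] // [] /addnI/val_inj -> ->.
Qed.

Let flr a b : fl a <> fr b.
Proof.
by case: a b => [[i|i] k] [[j|j] l] // [] e _;
  have := ltn_ord i; rewrite e ltnNge leq_addr.
Qed.

Lemma sp_tensorP (p : spart m x y) (q : spart m w z) :
  partition (sp_tensor_blocks p q) [set: sp_point m (x ++ w) (y ++ z)].
Proof.
have /and3P[/eqP cp tp p0] := blocksP p; have /and3P[/eqP cq tq q0] := blocksP q.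
apply: partition_setT.
- apply/negP; rewrite inE => /orP[] /imsetP[B BP e].
    suff B0 : B = set0 by rewrite -B0 BP in p0.
    by apply/eqP; rewrite -(imset_eq0 fl); apply/eqP; rewrite [RHS]e.
  suff B0 : B = set0 by rewrite -B0 BP in q0.
  by apply/eqP; rewrite -(imset_eq0 fr); apply/eqP; rewrite [RHS]e.
- have hl a : exists2 B, B \in sp_tensor_blocks p q & fl a \in B.
    have : a \in cover p by rewrite cp inE.
    case/bigcupP => B BP aB; exists (fl @: B); last exact: imset_f.
    by rewrite inE; apply/orP; left; exact: imset_f.
  have hr a : exists2 B, B \in sp_tensor_blocks p q & fr a \in B.
    have : a \in cover q by rewrite cq inE.
    case/bigcupP => B BP aB; exists (fr @: B); last exact: imset_f.
    by rewrite inE; apply/orP; right; exact: imset_f.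
  case=> [[i|i] l]; case: (ord_split i) => -[j ->].
  + exact: (hl (inl j, l)).
  + exact: (hr (inl j, l)).
  + exact: (hl (inr j, l)).
  + exact: (hr (inr j, l)).
- move=> a B1 B2; rewrite !inE => /orP[] /imsetP[C1 h1 ->] /orP[] /imsetP[C2 h2 ->].
  + move=> /imsetP[b1 b1C ->] /imsetP[b2 b2C /fl_inj e]; subst b2.
    by rewrite -(def_pblock tp h2 b2C) (def_pblock tp h1 b1C).
  + by move=> /imsetP[b1 _ ->] /imsetP[b2 _ /flr].
  + by move=> /imsetP[b1 _ ->] /imsetP[b2 _ /esym/flr].
  + move=> /imsetP[b1 b1C ->] /imsetP[b2 b2C /fr_inj e]; subst b2.
    by rewrite -(def_pblock tq h2 b2C) (def_pblock tq h1 b1C).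
Qed.

Definition sp_tensor (p : spart m x y) (q : spart m w z) :
  spart m (x ++ w) (y ++ z) := SPart (sp_tensorP p q).

End Tensor.

Section Composition.
Variables (m : nat) (x y z : word) (p : spart m y z) (q : spart m x y).

(* The points of q on top of p, the lower row of q and the upper row of p being
   identified to the single middle row y. *)
Definition stack_point : finType :=
  (('I_(size x) + 'I_(size y) + 'I_(size z)) * 'I_m)%type.

Definition stack_top (a : sp_point m x y) : stack_point :=
  (match a.1 with inl i => inl (inl i) | inr i => inl (inr i) end, a.2).

Definition stack_bot (a : sp_point m y z) : stack_point :=
  (match a.1 with inl i => inl (inr i) | inr i => inr i end, a.2).

Definition stack_outer (a : sp_point m x z) : stack_point :=
  (match a.1 with inl i => inl (inl i) | inr i => inr i end, a.2).

Definition stack_rel : rel stack_point := [rel a b |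
  [exists B in blocks q, (a \in stack_top @: B) && (b \in stack_top @: B)]
  || [exists B in blocks p, (a \in stack_bot @: B) && (b \in stack_bot @: B)]].

(* The merged blocks are the connected components of [stack_rel]; the blocks of
   the composition are their nonempty traces on the outer points. *)
Definition sp_comp_blocks : {set {set sp_point m x z}} :=
  equivalence_partition
    [rel a b | connect stack_rel (stack_outer a) (stack_outer b)] [set: sp_point m x z].

Lemma sp_compP : partition sp_comp_blocks [set: sp_point m x z].
Proof.
apply: equivalence_partitionP => a b c _ _ _ /=; split; first exact: connect0.
have sym : connect_sym stack_rel.
  apply: sym_connect_sym => s t /=.
  by congr (_ || _); apply: eq_existsb => B; rewrite [(s \in _) && _]andbC.
move=> ab; apply/idP/idP; last exact: connect_trans.
by apply: connect_trans; rewrite sym.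
Qed.

Definition sp_comp : spart m x z := SPart sp_compP.

End Composition.

Section Identity.
Variables (m : nat) (x : word).

Definition sp_id_blocks : {set {set sp_point m x x}} :=
  [set [set (inl il.1, il.2); (inr il.1, il.2)] | il : 'I_(size x) * 'I_m].

Lemma sp_idP : partition sp_id_blocks [set: sp_point m x x].
Proof.
apply: partition_setT.
- by apply/negP => /imsetP[[i l] _] /setP/(_ (inl i, l)); rewrite !inE eqxx.
- move=> [[i|i] l]; exists [set (inl i, l); (inr i, l)];
    by rewrite ?set21 ?set22 //; apply/imsetP; exists (i, l).
- move=> a B1 B2 /imsetP[[i l] _ ->] /imsetP[[j k] _ ->].
  by rewrite !inE => /orP[] /eqP -> /orP[] /eqP [] // -> ->.
Qed.

Definition sp_id : spart m x x := SPart sp_idP.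

End Identity.

(** * Categories of spatial partitions *)

(* A subset of the disjoint union of all the P^(m)(x, y). *)
Definition spart_family (m : nat) := forall x y : word, spart m x y -> Prop.

Definition is_category m (C : spart_family m) : Prop :=
  [/\ forall x y z (p : spart m y z) (q : spart m x y),
        C _ _ p -> C _ _ q -> C _ _ (sp_comp p q),
      forall x y w z (p : spart m x y) (q : spart m w z),
        C _ _ p -> C _ _ q -> C _ _ (sp_tensor p q),
      forall x y (p : spart m x y), C _ _ p -> C _ _ (sp_star p),
      C _ _ (sp_id m [:: White]) &
      C _ _ (sp_id m [:: Black])].

Definition is_rigid m (C : spart_family m) : Prop :=
  exists (r : spart m [::] [:: White; Black]) (s : spart m [::] [:: Black; White]),
  [/\ C _ _ r, C _ _ s,
      sp_comp (sp_tensor (sp_star r) (sp_id m [:: White]))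
              (sp_tensor (sp_id m [:: White]) s) = sp_id m [:: White] &
      sp_comp (sp_tensor (sp_star s) (sp_id m [:: Black]))
              (sp_tensor (sp_id m [:: Black]) r) = sp_id m [:: Black]].

Definition sp_graded m (n : 'I_m -> nat) x y (p : spart m x y) : Prop :=
  forall (B : {set sp_point m x y}) a b,
    B \in blocks p -> a \in B -> b \in B -> n a.2 = n b.2.

Definition is_graded m (n : 'I_m -> nat) (C : spart_family m) : Prop :=
  forall x y (p : spart m x y), C _ _ p -> sp_graded n p.

(** * Flattening *)

Section Flattening.
Variables (m : nat) (z : word).
Local Notation d := (size z).

(* A level l : 'I_(m * d) is j + c * m with j < m and c < d. *)
Lemma lev_base_subproof (l : 'I_(m * d)) : (l %% m < m)%N.
Proof. by case: m l => [|k] [l hl] //; rewrite ltn_pmod. Qed.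

Lemma lev_copy_subproof (l : 'I_(m * d)) : (l %/ m < d)%N.
Proof.
case: m l => [|k] [l hl] //=.
by rewrite ltn_divLR // [(size z * _)%N]mulnC.
Qed.

Definition lev_base (l : 'I_(m * d)) : 'I_m := Ordinal (lev_base_subproof l).
Definition lev_copy (l : 'I_(m * d)) : 'I_d := Ordinal (lev_copy_subproof l).

Lemma size_flat_word x : size (flat_word z x) = (size x * d)%N.
Proof.
elim: x => //= c x IH; rewrite size_cat IH mulSn; congr (_ + _)%N.
by case: c => //; rewrite /word_bar size_rev size_map.
Qed.

Lemma flat_pos_subproof x (i : 'I_(size x)) (c : 'I_d) :
  (i * d + c < size (flat_word z x))%N.
Proof.
rewrite size_flat_word; apply: (@leq_trans (i.+1 * d)).
  by rewrite mulSn [X in (_ <= X)%N]addnC ltn_add2l.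
by rewrite leq_mul2r ltn_ord orbT.
Qed.

Definition flat_pos x (i : 'I_(size x)) (c : 'I_d) : 'I_(size (flat_word z x)) :=
  Ordinal (flat_pos_subproof i
    (match letter i with White => c | Black => rev_ord c end)).

Definition flat_leg x y (a : leg x y) (c : 'I_d) :
    leg (flat_word z x) (flat_word z y) :=
  match a with inl i => inl (flat_pos i c) | inr i => inr (flat_pos i c) end.

Definition flat_point x y (a : sp_point (m * d) x y) :
    sp_point m (flat_word z x) (flat_word z y) :=
  (flat_leg a.1 (lev_copy a.2), lev_base a.2).

Lemma flat_pos_inj x i c i' c' :
  @flat_pos x i c = flat_pos i' c' -> i = i' /\ c = c'.
Proof.
move=> /(congr1 val)/=.
set u := match letter i with White => c | Black => rev_ord c end.
set u' := match letter i' with White => c' | Black => rev_ord c' end.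
have d0 : (0 < d)%N by apply: leq_ltn_trans (ltn_ord c).
move=> e; have ei : i = i'.
  apply: val_inj; have := congr1 (divn^~ d) e.
  by rewrite !divnMDl // !divn_small // !addn0.
split=> //; move: e; rewrite {}/u {}/u' -{}ei => /addnI/val_inj.
by case: (letter i) => // /rev_ord_inj.
Qed.

Lemma lev_inj l l' :
  lev_base l = lev_base l' -> lev_copy l = lev_copy l' -> l = l'.
Proof.
move=> /(congr1 val)/= e1 /(congr1 val)/= e2; apply: val_inj => /=.
by rewrite (divn_eq l m) (divn_eq l' m) e1 e2.
Qed.

Lemma flat_point_bij x y : bijective (@flat_point x y).
Proof.
apply: inj_card_bij; last first.
  rewrite !card_prod !card_sum !card_ord !size_flat_word.
  by rewrite -mulnDl -mulnA leq_mul2l [(size z * m)%N]mulnC leqnn orbT.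
move=> [a l] [b k] ab.
have el : lev_base l = lev_base k := congr1 snd ab.
case: a b ab => [i|i] [j|j] // [e _];
  have [-> ec] : i = j /\ lev_copy l = lev_copy k
    by apply: flat_pos_inj; apply: val_inj; exact: e.
- by rewrite (lev_inj el ec).
- by rewrite (lev_inj el ec).
Qed.

Definition sp_flat x y (p : spart (m * d) x y) :
    spart m (flat_word z x) (flat_word z y) :=
  SPart (partition_bij (@flat_point_bij x y) (blocksP p)).

Definition flat_preimage (C : spart_family m) : spart_family (m * d) :=
  fun x y p => C _ _ (sp_flat p).

(* (n_1, ..., n_m) repeated d times. *)
Definition flat_grading (n : 'I_m -> nat) : 'I_(m * d) -> nat :=
  fun l => n (lev_base l).

End Flattening.
Arguments sp_flat {m} z {x y} p.
Arguments flat_preimage {m} z C.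
Arguments flat_grading {m} z n.

(** * Unital C*-algebras over R[i] *)

From mathcomp Require Import all_order all_algebra.
From mathcomp Require Import all_classical all_reals all_analysis.
From mathcomp Require Import complex.

Import Order.TTheory GRing.Theory Num.Theory.
Import numFieldNormedType.Exports.

Local Open Scope ring_scope.
Local Open Scope classical_set_scope.

(* Ring and norm structures have no common extension in the hierarchy below
   [numDomainType], so the norm is given by hand; the resulting normed space is
   carried by the copy [nalg_space]. As in the library, the norm takes
   (automatically nonnegative) values in R[i]. *)
Record normedAlg (R : realType) := NormedAlg {
  nalg_alg :> algType R[i];
  nalg_norm : nalg_alg -> R[i];
  nalg_normD : forall a b, nalg_norm (a + b) <= nalg_norm a + nalg_norm b;
  nalg_normZ : forall (k : R[i]) a, nalg_norm (k *: a) = `|k| * nalg_norm a;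
  nalg_norm_eq0 : forall a, nalg_norm a = 0 -> a = 0;
  nalg_normM : forall a b, nalg_norm (a * b) <= nalg_norm a * nalg_norm b
}.

Definition nalg_space (R : realType) (A : normedAlg R) : Type := A.

HB.instance Definition _ (R : realType) (A : normedAlg R) :=
  GRing.Lmodule.on (nalg_space A).
HB.instance Definition _ (R : realType) (A : normedAlg R) :=
  Lmodule_isNormed.Build R[i] (nalg_space A)
    (@nalg_normD R A) (@nalg_normZ R A) (@nalg_norm_eq0 R A).

Record cstarAlg (R : realType) := CStarAlg {
  cstar_nalg :> normedAlg R;
  star : cstar_nalg -> cstar_nalg;
  starD : forall a b, star (a + b) = star a + star b;
  starZ : forall (k : R[i]) a, star (k *: a) = k^* *: star a;
  starM : forall a b, star (a * b) = star b * star a;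
  starK : involutive star;
  cstar_norm : forall a, nalg_norm (star a * a) = nalg_norm a ^+ 2;
  cstar_complete : forall F : set_system (nalg_space cstar_nalg),
    ProperFilter F -> cauchy F -> cvg F
}.

Definition is_star_morphism (R : realType) (A B : cstarAlg R)
    (f : {lrmorphism A -> B}) : Prop :=
  forall a, f (star a) = star (f a).

(** ** The unital C*-subalgebra generated by a set *)

Section Generated.
Variables (R : realType) (A : cstarAlg R).

Definition is_cstar_subalg (B : set A) : Prop :=
  [/\ closed (B : set (nalg_space A)), B 1,
      forall (k : R[i]) a b, B a -> B b -> B (k *: a + b),
      forall a b, B a -> B b -> B (a * b) &
      forall a, B a -> B (star a)].

Definition cstar_gen (S : set A) : set A := smallest is_cstar_subalg S.

Lemma cstar_genP S : is_cstar_subalg (cstar_gen S).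
Proof.
split.
- by apply: closed_bigI => B [[]].
- by move=> B [[]].
- by move=> k a b Ha Hb B hB; have [[_ _ h _ _] _] := hB;
    apply: h; [exact: Ha|exact: Hb].
- by move=> a b Ha Hb B hB; have [[_ _ _ h _] _] := hB;
    apply: h; [exact: Ha|exact: Hb].
- by move=> a Ha B hB; have [[_ _ _ _ h] _] := hB; apply: h; exact: Ha.
Qed.

Variable S : set A.

Definition cstar_sub : Type := {a : A | a \in cstar_gen S}.

HB.instance Definition _ := [isSub of cstar_sub for sval].
HB.instance Definition _ := [Choice of cstar_sub by <:].

Lemma cstar_sub_closed :
    GRing.subsemialg_closed (mem (cstar_gen S)).
Proof.
have [_ S1 Slin SM _] := cstar_genP S.
have S0 : cstar_gen S 0 by rewrite -(addNr 1) -scaleN1r; exact: Slin.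
split; first by rewrite inE.
- split=> [|a b]; rewrite !inE // => Sa Sb.
  by rewrite -[a]scale1r; exact: Slin.
- by move=> k a; rewrite !inE => Sa; rewrite -[_ *: _]addr0; exact: Slin.
- by move=> a b; rewrite !inE; exact: SM.
Qed.

HB.instance Definition _ :=
  GRing.SubChoice_isSubAlgebra.Build R[i] A (mem (cstar_gen S)) cstar_sub
    cstar_sub_closed.

Definition cstar_sub_norm (a : cstar_sub) : R[i] := nalg_norm (val a).

Definition cstar_sub_star (a : cstar_sub) : cstar_sub.
Proof.
exists (star (val a)).
by have [_ _ _ _ h] := cstar_genP S; rewrite inE; apply: h; have := valP a; rewrite inE.
Defined.

Definition cstar_sub_nalg : normedAlg R.
Proof.
refine (@NormedAlg R cstar_sub cstar_sub_norm _ _ _ _).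
- by move=> a b; rewrite /cstar_sub_norm rmorphD; exact: nalg_normD.
- by move=> k a; rewrite /cstar_sub_norm linearZ; exact: nalg_normZ.
- by move=> a /nalg_norm_eq0 a0; apply: val_inj; rewrite rmorph0.
- by move=> a b; rewrite /cstar_sub_norm rmorphM; exact: nalg_normM.
Defined.

Lemma cstar_sub_complete (F : set_system (nalg_space cstar_sub_nalg)) :
  ProperFilter F -> cauchy F -> cvg F.
Proof.
move=> FF Fc.
pose i (a : nalg_space cstar_sub_nalg) : nalg_space A := val (a : cstar_sub).
have iball a b e : ball (i a) e (i b) = ball a e b.
  rewrite -!ball_normE /ball_ /=.
  have h (u v : cstar_sub) : nalg_norm (val u - val v) = cstar_sub_norm (u - v).
    by rewrite /cstar_sub_norm rmorphB.
  by congr (_ < _); exact: h.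
have Fc' : cauchy (i @ F).
  apply/cauchy_ballP => e e0; move/cauchy_ballP : Fc => /(_ e e0).
  move=> [[P Q] /= [FP FQ] PQ]; exists (i @` P, i @` Q) => /=.
    by split; rewrite /nbhs /=; [apply: filterS FP|apply: filterS FQ] => a ? /=;
      exists a.
  by move=> _ [[a Pa <-] [b Qb <-]] /=; rewrite iball; exact: (PQ (a, b)).
have /cvg_ex[l Fl] := cstar_complete (fmap_proper_filter i FF) Fc'.
have lS : l \in cstar_gen S.
  rewrite inE; have [Scl _ _ _ _] := cstar_genP S.
  apply: (@closed_cvg _ _ F FF i _ Scl _ _ Fl).
  by apply: nearW => a; have := valP (a : cstar_sub); rewrite inE.
apply/cvg_ex; exists (Sub l lS : cstar_sub); apply/cvg_ballP => e e0.
move/cvg_ballP : Fl => /(_ e e0); apply: filterS => a; rewrite -iball.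
by rewrite /i SubK.
Qed.

Definition cstar_sub_cstar : cstarAlg R.
Proof.
refine (@CStarAlg R cstar_sub_nalg cstar_sub_star _ _ _ _ _ cstar_sub_complete).
- by move=> a b; apply: val_inj; rewrite /= starD.
- by move=> k a; apply: val_inj; rewrite /= starZ.
- by move=> a b; apply: val_inj; rewrite /= starM.
- by move=> a; apply: val_inj; rewrite /= starK.
- by move=> a; rewrite /= /cstar_sub_norm /= cstar_norm.
Defined.

End Generated.

(** ** The (minimal, i.e. spatial) tensor product of C*-algebras *)

Record hilbert (R : realType) := Hilbert {
  hilbert_space :> completeNormedModType R[i];
  dot : hilbert_space -> hilbert_space -> R[i];
  dotDl : forall x y z, dot (x + y) z = dot x z + dot y z;
  dotZl : forall (k : R[i]) x z, dot (k *: x) z = k * dot x z;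
  dotC : forall x y, dot y x = (dot x y)^*;
  dot_norm : forall x, dot x x = `|x| ^+ 2
}.

(* Unital representation by bounded operators. *)
Record is_star_rep (R : realType) (A : cstarAlg R) (H : hilbert R)
    (pi : A -> H -> H) : Prop := IsStarRep {
  star_rep_op : forall a, linear (pi a) /\ continuous (pi a);
  star_rep_lin : forall (k : R[i]) a b x,
    pi (k *: a + b) x = k *: pi a x + pi b x;
  star_rep_mul : forall a b x, pi (a * b) x = pi a (pi b x);
  star_rep_one : forall x, pi 1 x = x;
  star_rep_star : forall a x y, dot (pi (star a) x) y = dot x (pi a y)
}.

Definition is_faithful (R : realType) (A : cstarAlg R) (H : hilbert R)
    (pi : A -> H -> H) : Prop :=
  forall a, (forall x, pi a x = 0) -> a = 0.

(* [t] exhibits [K] as the Hilbert space tensor product of [H1] and [H2]; the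
   bilinearity of [t] follows from the formula for the inner products. *)
Definition is_hilbert_tensor (R : realType) (H1 H2 K : hilbert R)
    (t : H1 -> H2 -> K) : Prop :=
  (forall x1 x2 y1 y2, dot (t x1 x2) (t y1 y2) = dot x1 y1 * dot x2 y2) /\
  closure [set x : K | exists s : seq (H1 * H2), x = \sum_(p <- s) t p.1 p.2]
    = [set: K].

(* [t] exhibits [B] as the tensor product of [A1] and [A2]: up to isomorphism,
   [B] is the closed linear span of the operators pi1(a) (x) pi2(b) on the
   Hilbert space tensor product, for faithful representations pi1 and pi2. *)
Definition is_cstar_tensor (R : realType) (A1 A2 B : cstarAlg R)
    (t : A1 -> A2 -> B) : Prop :=
  closure ([set b | exists s : seq (A1 * A2), b = \sum_(p <- s) t p.1 p.2]
           : set (nalg_space B)) = [set: nalg_space B] /\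
  exists (H1 H2 K : hilbert R) (th : H1 -> H2 -> K)
         (pi1 : A1 -> H1 -> H1) (pi2 : A2 -> H2 -> H2) (rho : B -> K -> K),
  [/\ is_hilbert_tensor th,
      is_star_rep pi1 /\ is_faithful pi1,
      is_star_rep pi2 /\ is_faithful pi2,
      is_star_rep rho /\ is_faithful rho &
      forall a b x y, rho (t a b) (th x y) = th (pi1 a x) (pi2 b y)].

(** * Compact matrix quantum groups *)

(* A finite-dimensional Hilbert space is given by the finite index set of an
   orthonormal basis (e_i); its conjugate has the basis of the conjugates of the
   e_i, and a tensor product has the basis of the tensors. Elements of
   B(V) (x) A and linear maps are matrices [M i j], with i the row, i.e. output,
   index; matrices over A and over R[i] are treated uniformly. *)

Section Matrices.
Variable A : pzRingType.

Definition fmx (I J : Type) := I -> J -> A.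

Definition fmx_mul (I K J : finType) (M : fmx I K) (N : fmx K J) : fmx I J :=
  fun i j => \sum_k M i k * N k j.

Definition fmx_one (I : finType) : fmx I I := fun i j => (i == j)%:R.

Definition fmx_invertible (I : finType) (M : fmx I I) : Prop :=
  exists N : fmx I I,
    (forall i j, fmx_mul M N i j = fmx_one i j) /\
    (forall i j, fmx_mul N M i j = fmx_one i j).

(* The tensor product of the matrices M^{x_1}, ..., M^{x_|x|}, the colours
   selecting between Mo and Mb; the factors are multiplied in this order. *)
Definition fmx_word (I J : finType) (Mo Mb : fmx I J) (x : word) :
    fmx {ffun 'I_(size x) -> I} {ffun 'I_(size x) -> J} :=
  fun i j => \prod_(k < size x)
    (match letter k with White => Mo | Black => Mb end) (i k) (j k).

End Matrices.
Arguments fmx_word {A I J} Mo Mb x.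

Section Unitary.
Variables (R : realType) (I J : finType).

Definition cmx_adj (M : fmx R[i] I J) : fmx R[i] J I := fun j i => (M i j)^*.

Definition cmx_conj (M : fmx R[i] I J) : fmx R[i] I J := fun i j => (M i j)^*.

Definition cmx_unitary (M : fmx R[i] I J) : Prop :=
  (forall i j, fmx_mul M (cmx_adj M) i j = fmx_one _ i j) /\
  (forall i j, fmx_mul (cmx_adj M) M i j = fmx_one _ i j).

Variable A : cstarAlg R.

Definition amx_adj (u : fmx A I I) : fmx A I I := fun i j => star (u j i).

Definition amx_conj (u : fmx A I I) : fmx A I I := fun i j => star (u i j).

Definition amx_unitary (u : fmx A I I) : Prop :=
  (forall i j, fmx_mul u (amx_adj u) i j = fmx_one _ i j) /\
  (forall i j, fmx_mul (amx_adj u) u i j = fmx_one _ i j).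

End Unitary.
Arguments cmx_unitary {R I J} M.

Definition amx_tensor (R : realType) (A : cstarAlg R) (I J : finType)
    (u : fmx A I I) (v : fmx A J J) : fmx A (I * J)%type (I * J)%type :=
  fun i j => u i.1 j.1 * v i.2 j.2.

Definition intertwiner (R : realType) (A : cstarAlg R) (I J : finType)
    (v : fmx A I I) (w : fmx A J J) (T : fmx R[i] J I) : Prop :=
  forall j i, \sum_k T j k *: v k i = \sum_k T k i *: w j k.

(* The pair (C(G), u). *)
Record cmqg_data (R : realType) := CmqgData {
  qalg : cstarAlg R;
  qdim : finType;
  qfund : fmx qalg qdim qdim
}.
Arguments qfund {R} c.

(* The comultiplication, together with its codomain C(G) (x) C(G). *)
Record comult (R : realType) (A : cstarAlg R) := Comult {
  comult_cod : cstarAlg R;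
  comult_tens : A -> A -> comult_cod;
  comult_tensP : is_cstar_tensor comult_tens;
  comult_map :> {lrmorphism A -> comult_cod};
  comult_star : is_star_morphism comult_map
}.

Definition is_corep (R : realType) (A : cstarAlg R) (D : comult A) (I : finType)
    (v : fmx A I I) : Prop :=
  forall i j, D (v i j) = \sum_k comult_tens D (v i k) (v k j).

Definition is_cmqg (R : realType) (G : cmqg_data R) (D : comult (qalg G)) : Prop :=
  [/\ cstar_gen [set a | exists i j, a = qfund G i j] = [set: qalg G],
      amx_unitary (qfund G),
      fmx_invertible (amx_conj (qfund G)) &
      is_corep D (qfund G)].

(* A unitary matrix is invertible. *)
Definition is_unitary_rep (R : realType) (A : cstarAlg R) (D : comult A)
    (I : finType) (v : fmx A I I) : Prop :=
  amx_unitary v /\ is_corep D v.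

(** * Spatial partition quantum groups *)

Section PartitionMaps.
Variables (R : realType) (m : nat) (n : 'I_m -> nat).

Definition multi_index : finType := {dffun forall k : 'I_m, 'I_(n k)}.

Definition point_label x y
    (i : {ffun 'I_(size y) -> multi_index}) (j : {ffun 'I_(size x) -> multi_index})
    (a : sp_point m x y) : nat :=
  match a.1 with inl k => j k a.2 | inr k => i k a.2 end.

Definition sp_map x y (p : spart m x y) :
    fmx R[i] {ffun 'I_(size y) -> multi_index} {ffun 'I_(size x) -> multi_index} :=
  fun i j => [forall B in blocks p, forall a in B, forall b in B,
                point_label i j a == point_label i j b]%:R.

End PartitionMaps.
Arguments sp_map R {m} n {x y} p.

Definition in_span (R : realType) (I J : Type) (S : fmx R[i] I J -> Prop)
    (T : fmx R[i] I J) : Prop :=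
  exists (k : nat) (c : 'I_k -> R[i]) (M : 'I_k -> fmx R[i] I J),
    (forall l, S (M l)) /\ forall i j, T i j = \sum_l c l * M l i j.

(* For a unitary Q one has Q^-1 = [cmx_adj Q]. *)
Definition sp_intertwiner (R : realType) m (n : 'I_m -> nat) (I : finType)
    (Q : fmx R[i] I (multi_index n)) x y (p : spart m x y) :
    fmx R[i] {ffun 'I_(size y) -> I} {ffun 'I_(size x) -> I} :=
  fmx_mul (fmx_word Q (cmx_conj Q) y)
    (fmx_mul (sp_map R n p)
       (fmx_word (cmx_adj Q) (cmx_conj (cmx_adj Q)) x)).

Arguments sp_intertwiner {R m n I} Q {x y} p.

(* The comultiplication is determined by u up to the choice of its codomain, so
   it is not part of the data of G. *)
Definition corresponds_to (R : realType) (G : cmqg_data R) (m : nat)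
    (n : 'I_m -> nat) (C : spart_family m) : Prop :=
  [/\ (0 < m)%N, is_category C, is_rigid C, is_graded n C &
   exists D : comult (qalg G), is_cmqg D /\
   exists (ub : fmx (qalg G) (qdim G) (qdim G))
          (Q : fmx R[i] (qdim G) (multi_index n)),
   [/\ is_unitary_rep D ub, cmx_unitary Q &
    forall (x y : word) (T : fmx R[i] {ffun 'I_(size y) -> qdim G}
                             {ffun 'I_(size x) -> qdim G}),
      intertwiner (fmx_word (qfund G) ub x) (fmx_word (qfund G) ub y) T <->
      in_span (fun T' => exists2 p : spart m x y, C x y p & T' = sp_intertwiner Q p) T]].

Definition is_spatial_partition_qg (R : realType) (G : cmqg_data R) : Prop :=
  exists m (n : 'I_m -> nat) (C : spart_family m), corresponds_to G n C.

(** * The projective version *)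

Section Projective.
Variables (R : realType) (G : cmqg_data R).

Definition proj_fund : fmx (qalg G) (qdim G * qdim G)%type (qdim G * qdim G)%type :=
  amx_tensor (qfund G) (amx_conj (qfund G)).

Definition proj_entries : set (qalg G) := [set a | exists i j, a = proj_fund i j].

Lemma proj_fundP i j : proj_fund i j \in cstar_gen proj_entries.
Proof. by rewrite inE; apply: sub_gen_smallest; exists i, j. Qed.

Definition projective_version : cmqg_data R :=
  @CmqgData R (cstar_sub_cstar proj_entries) (qdim G * qdim G)%type
    (fun i j => Sub (proj_fund i j) (proj_fundP i j) : cstar_sub proj_entries).

End Projective.
Arguments proj_fund {R} G.

(* Main.v *)
From HB Require Import structures.
Require Import Defs.
From mathcomp Require Import all_boot all_order all_algebra all_reals.

Set Implicit Arguments.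
Unset Strict Implicit.
Unset Printing Implicit Defensive.

(* The flattening is injective and functorial, so [flat_preimage wb C] is a category, and
   for cups r, s of C the nested cup (id (x) s (x) id) r is a cup for both colours of
   the flattened category. Such identities between partitions are checked on the
   relations "f and g are constant on the blocks of p" between labellings of the upper
   and lower rows: composition of partitions is composition of these relations, and
   labels in {0, 1} already determine p. On labels in [n] the two snake equations make
   the relations of r and s inverse to each other, so T_r is a permutation matrix and
   E = conj (Q T_r Q^* ) is a unitary with E ub = conj u E. Hence conj u is unitary, and
   conjugating the white factor u (x) ub and its flip by W = 1 (x) E and conj W yields
   u (x) conj u and a unitary representation for the black letter; the Hom spaces of PG
   are then the Hom spaces of G between flattened words, conjugated by unitaries.

   The comultiplication of PG is the restriction of that of G. That its values stay in
   the closed span of the elementary tensors rests on the continuity of *-morphisms: for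
   a = a^* with |a| <= 1/2, the element a + i sqrt(1 - a^2) is unitary, so its image has
   norm 1. *)

Local Notation wb := [:: White; Black].

(** The data of G describe Hom spaces of words in [u] and some unitary representation [ub], whereas
    PG is built from the entrywise adjoint of [u]. The fixed vector given by the cup [r] links the
    two, and the link is unitary for purely combinatorial reasons. Reversing and flipping
    white-black gives white-black again: both colours flatten to the same word and differ only in
    the order of the two copies of the levels. Hence one nested cup serves for both colours, and the
    black letter of PG involves a flip. Relations replace the maps T_p because T_p T_q carries a
    scalar for every closed component deleted in the composition, while the existence of middle
    labels does not count them. The tensor product of C*-algebras is given only through faithful
    representations, so the algebraic laws of elementary tensors have to be read off on Hilbert
    spaces before corepresentations can be multiplied or conjugated. *)

Definition const_on (T : finType) (P : {set {set T}}) (phi : T -> nat) : bool :=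
  [forall B in P, forall a in B, forall b in B, phi a == phi b].

Lemma const_onP (T : finType) (P : {set {set T}}) (phi : T -> nat) :
  reflect (forall (B : {set T}) a b, B \in P -> a \in B -> b \in B -> phi a = phi b)
          (const_on P phi).
Proof.
apply: (iffP forall_inP) => [h B a b BP aB bB | h B BP].
  by have /forall_inP/(_ a aB)/forall_inP/(_ b bB)/eqP := h B BP.
by apply/forall_inP => a aB; apply/forall_inP => b bB; apply/eqP/(h B).
Qed.

Lemma const_on_imset (T T' : finType) (f : T -> T') (P : {set {set T}}) phi :
  const_on [set [set f a | a in B] | B : {set T} in P] phi = const_on P (phi \o f).
Proof.
apply/const_onP/const_onP => h B a b.
  by move=> BP aB bB; apply: (h (f @: B)); rewrite ?imset_f.
case/imsetP => B' BP ->; case/imsetP => a' aB ->; case/imsetP => b' bB ->.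
exact: (h B').
Qed.

Lemma eq_const_on (T : finType) (P : {set {set T}}) (phi psi : T -> nat) :
  phi =1 psi -> const_on P phi = const_on P psi.
Proof.
by move=> e; apply/const_onP/const_onP => h B a b BP aB bB;
  have := h B a b BP aB bB; rewrite !e.
Qed.

(** The test labelling is the indicator of a block B of P: it is constant on every block of P, hence
    on every block of Q, so a block of Q that meets B lies inside B. Exchanging P and Q gives
    equality. *)
Lemma const_on_partition_inj (T : finType) (P Q : {set {set T}}) :
  partition P [set: T] -> partition Q [set: T] ->
  (forall phi : T -> nat, (forall a, phi a < 2) -> const_on P phi = const_on Q phi) ->
  P = Q.
Proof.
suff sub (P' Q' : {set {set T}}) : partition P' [set: T] -> partition Q' [set: T] ->
    (forall phi : T -> nat, (forall a, phi a < 2) ->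
        const_on P' phi -> const_on Q' phi) ->
    forall B B', B \in P' -> B' \in Q' -> forall a, a \in B -> a \in B' -> B' \subset B.
  suff sub2 (P' Q' : {set {set T}}) : partition P' [set: T] ->
      partition Q' [set: T] ->
      (forall phi : T -> nat, (forall a, phi a < 2) ->
        const_on P' phi = const_on Q' phi) -> P' \subset Q'.
    move=> hP hQ h; apply/eqP; rewrite eqEsubset !sub2 // => phi /h ->; exact: erefl.
  move=> hP hQ h; apply/subsetP => B BP.
  have /and3P[_ _ P0] := hP.
  have [a aB] : exists a, a \in B by apply/set0Pn; apply: contraNneq P0 => <-.
  have /and3P[/eqP cQ _ _] := hQ.
  have : a \in cover Q' by rewrite cQ inE.
  case/bigcupP => B' B'Q aB'.
  suff -> : B = B' by [].
  apply/eqP; rewrite eqEsubset; apply/andP; split.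
    by apply: (sub Q' P' hQ hP _ B' B B'Q BP a) => // phi /h ->.
  by apply: (sub P' Q' hP hQ _ B B' BP B'Q a) => // phi /h ->.
move=> hP hQ h B B' BP B'Q a aB aB'; apply/subsetP => b bB'.
have /const_onP/(_ B' a b B'Q aB' bB') : const_on Q' (fun c => c \in B : nat).
  apply: h => [c|]; first by case: (c \in B).
  apply/const_onP => D c d DP cD dD; congr (nat_of_bool _).
  have /and3P[_ tP _] := hP.
  have [eDB|nDB] := eqVneq D B; first by rewrite -eDB cD dD.
  have /pred0P dis := trivIsetP tP _ _ DP BP nDB.
  by have := dis c; have := dis d; rewrite /= cD dD /= => -> ->.
by rewrite aB; case: (b \in B).
Qed.

Lemma spart_inj m x y : injective (@blocks m x y).
Proof.
by case=> P hP [Q hQ] /= e; subst Q; congr SPart; exact: bool_irrelevance.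
Qed.

(** * Partitions as relations between labellings *)

(* Labellings of a row of any length are indexed by nat, values outside of the row
   being ignored: words that are equal but not convertible then need no cast. *)
Definition labelling m := nat -> 'I_m -> nat.

Definition bounded m (n : 'I_m -> nat) (f : labelling m) := forall i l, f i l < n l.

Definition shift m (k : nat) (f : labelling m) : labelling m := fun i => f (k + i).

Definition lab m x y (f g : labelling m) (a : sp_point m x y) : nat :=
  match a.1 with inl i => f i a.2 | inr i => g i a.2 end.

Definition sp_rel m x y (p : spart m x y) (f g : labelling m) : bool :=
  const_on (blocks p) (lab f g).

Section Labellings.
Variable m : nat.
Implicit Types (x y z w : word) (f g h : labelling m).

(** Positions outside the rows receive the label 0, which is admissible because every [n l] is
    positive. *)
Lemma lab_ext x y (n : 'I_m -> nat) (phi : sp_point m x y -> nat) :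
  (forall l, 0 < n l) -> (forall a, phi a < n a.2) ->
  exists f g, [/\ bounded n f, bounded n g & lab f g =1 phi].
Proof.
move=> n0 hphi.
exists (fun i l => if insub i is Some i' then phi (inl i', l) else 0).
exists (fun i l => if insub i is Some i' then phi (inr i', l) else 0).
split.
- by move=> i l; case: insubP => [u _ _|_] //; exact: hphi.
- by move=> i l; case: insubP => [u _ _|_] //; exact: hphi.
- by case=> [[i|i] l]; rewrite /lab /= valK.
Qed.

Lemma sp_rel_eq x y (p : spart m x y) f f' g g' :
  (forall i l, i < size x -> f i l = f' i l) ->
  (forall i l, i < size y -> g i l = g' i l) ->
  sp_rel p f g = sp_rel p f' g'.
Proof.
by move=> ef eg; apply: eq_const_on => -[[i|i] l]; rewrite /lab /= ?ef ?eg.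
Qed.

Lemma sp_rel_inj x y (p q : spart m x y) :
  (forall f g, bounded (fun=> 2) f -> bounded (fun=> 2) g ->
     sp_rel p f g = sp_rel q f g) -> p = q.
Proof.
move=> h; apply: spart_inj; apply: const_on_partition_inj.
- exact: blocksP.
- exact: blocksP.
- move=> phi hphi; have [f [g [hf hg e]]] := @lab_ext x y (fun=> 2) phi (fun=> isT) hphi.
  by have := h f g hf hg; rewrite /sp_rel !(eq_const_on _ e).
Qed.

Lemma sp_rel_star x y (p : spart m x y) f g : sp_rel (sp_star p) f g = sp_rel p g f.
Proof.
by rewrite /sp_rel const_on_imset; apply: eq_const_on => -[[i|i] l].
Qed.

Lemma sp_rel_tensor x y w z (p : spart m x y) (q : spart m w z) f g :
  sp_rel (sp_tensor p q) f g =
  sp_rel p f g && sp_rel q (shift (size x) f) (shift (size y) g).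
Proof.
have constU (T : finType) (P Q : {set {set T}}) phi :
    const_on (P :|: Q) phi = const_on P phi && const_on Q phi.
  apply/const_onP/andP => [h|[/const_onP hP /const_onP hQ] B a b].
    by split; apply/const_onP => B a b hB; apply: (h B); rewrite inE hB ?orbT.
  by rewrite inE => /orP[]; [exact: hP|exact: hQ].
rewrite /sp_rel /= /sp_tensor_blocks constU !const_on_imset.
by congr (_ && _); apply: eq_const_on => -[[i|i] l].
Qed.

Lemma sp_rel_id x f g :
  sp_rel (sp_id m x) f g <-> forall i l, i < size x -> f i l = g i l.
Proof.
split=> [/const_onP h i l ix|h].
  pose i' := Ordinal ix.
  apply: (h [set (inl i', l); (inr i', l)] (inl i', l) (inr i', l));
    rewrite ?set21 ?set22 //.
  by apply/imsetP; exists (i', l).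
apply/const_onP => B a b /imsetP[[i l] _ ->].
by rewrite !inE => /orP[] /eqP -> /orP[] /eqP ->; rewrite /lab //= h.
Qed.

(** * Composition of partitions as composition of relations *)

Section Composition.
Variables (x y z : word) (p : spart m y z) (q : spart m x y).
Local Notation linked := (connect (stack_rel p q)).

Lemma stack_connect_sym : connect_sym (stack_rel p q).
Proof.
apply: sym_connect_sym => s t /=.
by congr (_ || _); apply: eq_existsb => D; rewrite [(s \in _) && _]andbC.
Qed.

Lemma sp_rel_connect f h :
  sp_rel (sp_comp p q) f h <->
  forall a b, linked (stack_outer y a) (stack_outer y b) -> lab f h a = lab f h b.
Proof.
have er : {in [set: sp_point m x z] & &, equivalence_rel
    [rel a b | linked (stack_outer y a) (stack_outer y b)]}.
  move=> c d e _ _ _ /=; split; first exact: connect0.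
  move=> cd; apply/idP/idP; last exact: connect_trans.
  by apply: connect_trans; rewrite stack_connect_sym.
have cov a : a \in cover (sp_comp p q) by rewrite (cover_partition (sp_compP p q)) inE.
have /and3P[_ tr _] := sp_compP p q.
split=> [/const_onP hc a b ab|h' ].
  apply: (hc (pblock (sp_comp p q) a)).
  - exact: pblock_mem.
  - by rewrite mem_pblock.
  - by rewrite /= pblock_equivalence_partition ?inE.
apply/const_onP => B a b BP aB; rewrite -(def_pblock tr BP aB).
by rewrite pblock_equivalence_partition ?inE //; exact: h'.
Qed.

(** A labelling of all three rows that is constant on blocks is constant on connected components.
    Conversely, outer labels constant on the traces of components extend to the middle row: each
    component takes the label of any of its outer points. *)
Lemma sp_rel_comp (n : 'I_m -> nat) f h :
  sp_graded n p -> sp_graded n q -> (forall l, 0 < n l) ->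
  bounded n f -> bounded n h ->
  sp_rel (sp_comp p q) f h <->
  exists g, [/\ bounded n g, sp_rel q f g & sp_rel p g h].
Proof.
move=> gp gq n0 bf bh; rewrite sp_rel_connect; split; last first.
  case=> g [_ /const_onP hq /const_onP hp] a b.
  pose slab (s : stack_point m x y z) : nat :=
    match s.1 with inl (inl i) => f i s.2 | inl (inr i) => g i s.2 | inr i => h i s.2 end.
  have step s t : stack_rel p q s t -> slab s = slab t.
    case/orP => /existsP[D /and3P[DP]] /imsetP[s' sD ->] /imsetP[t' tD ->].
      have := hq D s' t' DP sD tD.
      by case: s' t' {sD tD} => [[i|i] l] [[j|j] k].
    have := hp D s' t' DP sD tD.
    by case: s' t' {sD tD} => [[i|i] l] [[j|j] k].
  have steps s t : linked s t -> slab s = slab t.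
    case/connectP => r hr ->; elim: r s hr => //= u r IH s /andP[su ur].
    by rewrite (step _ _ su); exact: IH.
  have slab_outer c : slab (stack_outer y c) = lab f h c by case: c => [[i|i] l].
  by move=> /steps; rewrite !slab_outer.
move=> outerE.
(* Gradedness makes [n] constant along a component, so a label copied from an outer point stays
   within the bound at the level of the middle point. *)
have lvl s t : linked s t -> n s.2 = n t.2.
  case/connectP => r hr ->; elim: r s hr => //= u r IH s /andP[su ur].
  rewrite -(IH _ ur) {IH ur}.
  by case/orP: su => /existsP[D /and3P[DP]] /imsetP[s' sD ->] /imsetP[t' tD ->];
    [exact: (gq D)|exact: (gp D)].
(* A component without outer points is unconstrained and gets the label 0. *)
pose lbl (s : stack_point m x y z) : nat :=
  if [pick a | linked s (stack_outer y a)] is Some a then lab f h a else 0.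
have lblE s t : linked s t -> lbl s = lbl t.
  move=> st; rewrite /lbl; case: pickP => [a sa|sn]; case: pickP => [b tb|tn] //.
  - apply: outerE; apply: (connect_trans _ tb); apply: connect_trans st.
    by rewrite stack_connect_sym.
  - by have := tn a; rewrite (connect_trans _ sa) // stack_connect_sym.
  - by have := sn b; rewrite (connect_trans st tb).
have lbl_outer a : lbl (stack_outer y a) = lab f h a.
  by rewrite /lbl; case: pickP => [b /outerE //|/(_ a)]; rewrite connect0.
have lbl_bnd s : lbl s < n s.2.
  rewrite /lbl; case: pickP => [a /lvl ->|_ //].
  by case: a => [[i|i] l]; rewrite /lab /=.
pose g : labelling m := fun i l => if insub i is Some i' then lbl (inl (inr i'), l) else 0.
have lblq a : lab f g a = lbl (stack_top z a).
  case: a => [[i|i] l]; last by rewrite /lab /= /g valK.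
  by have := lbl_outer (inl i, l).
have lblp a : lab g h a = lbl (stack_bot x a).
  case: a => [[i|i] l]; first by rewrite /lab /= /g valK.
  by have := lbl_outer (inr i, l).
exists g; split.
- by move=> i l; rewrite /g; case: insubP => [u _ _|_] //; exact: lbl_bnd.
- apply/const_onP => B a b BP aB bB; rewrite !lblq; apply: lblE; apply: connect1.
  by apply/orP; left; apply/existsP; exists B; rewrite BP !imset_f.
- apply/const_onP => B a b BP aB bB; rewrite !lblp; apply: lblE; apply: connect1.
  by apply/orP; right; apply/existsP; exists B; rewrite BP !imset_f.
Qed.

(** Every partition is graded for a constant grading, so with labels 0 and 1 the rule holds for all
    partitions. *)
Lemma sp_rel_comp2 f h : bounded (fun=> 2) f -> bounded (fun=> 2) h ->
  sp_rel (sp_comp p q) f h <->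
  exists g, [/\ bounded (fun=> 2) g, sp_rel q f g & sp_rel p g h].
Proof. by apply: sp_rel_comp. Qed.

End Composition.

Lemma bounded_const (n : 'I_m -> nat) (a : 'I_m -> nat) :
  (forall l, a l < n l) -> bounded n (fun=> a).
Proof. by move=> h i l. Qed.

(** Words such as the flattening of [x ++ w] and the concatenation of the two flattenings are equal
    but not convertible; membership in [C] is moved between them by comparing relations, without
    casting partitions. *)
Lemma family_cast (C : spart_family m) x y x' y' (p : spart m x y) (q : spart m x' y') :
  x = x' -> y = y' ->
  (forall f g, bounded (fun=> 2) f -> bounded (fun=> 2) g ->
     sp_rel p f g = sp_rel q f g) ->
  C _ _ p -> C _ _ q.
Proof. by move=> ex ey; subst x' y' => /sp_rel_inj ->. Qed.

End Labellings.

(** * Flattening is functorial *)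

Section Flat.
Variables (m : nat) (z : word).
Local Notation d := (size z).
Implicit Types (x y w : word).

Lemma lev_subproof (k : 'I_m) (c : 'I_d) : k + c * m < m * d.
Proof.
rewrite [m * d]mulnC; apply: (@leq_trans (c.+1 * m)); last by rewrite leq_mul2r ltn_ord orbT.
by rewrite mulSn ltn_add2r.
Qed.

Definition lev (k : 'I_m) (c : 'I_d) : 'I_(m * d) := Ordinal (lev_subproof k c).

Lemma lev_base_lev k c : lev_base (lev k c) = k.
Proof. by apply: val_inj; rewrite /= addnC modnMDl modn_small. Qed.

Lemma lev_copy_lev k c : lev_copy (lev k c) = c.
Proof.
by apply: val_inj; rewrite /= addnC divnMDl ?divn_small ?addn0 //;
  case: (m) k => [[]|].
Qed.

Lemma levK (l : 'I_(m * d)) : lev (lev_base l) (lev_copy l) = l.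
Proof. by apply: lev_inj; rewrite ?lev_base_lev ?lev_copy_lev. Qed.

(** Pullback of a labelling along the flattening of points. At a black letter the copies are read
    backwards, [d - c.+1] being [rev_ord c]. The default colour concerns only positions beyond the
    word, whose labels are ignored. *)
Definition unflat x (F : labelling m) : labelling (m * d) := fun i l =>
  F (i * d + (if nth White x i is White then lev_copy l : nat else d - (lev_copy l).+1))
    (lev_base l).

Lemma unflat_lev x F i k c : unflat x F i (lev k c) =
  F (i * d + (if nth White x i is White then c : nat else d - c.+1)) k.
Proof. by rewrite /unflat lev_copy_lev lev_base_lev. Qed.

Lemma lab_flat x y F G (a : sp_point (m * d) x y) :
  lab F G (flat_point a) = lab (unflat x F) (unflat y G) a.
Proof.
by case: a => [[i|i] l]; rewrite /lab /unflat /= /letter (tnth_nth White) /=; case: nth.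
Qed.

Lemma sp_rel_flat x y (p : spart (m * d) x y) F G :
  sp_rel (sp_flat z p) F G = sp_rel p (unflat x F) (unflat y G).
Proof. by rewrite /sp_rel const_on_imset; apply: eq_const_on => a; rewrite /= lab_flat. Qed.

Lemma unflat_bounded (n : 'I_m -> nat) x F :
  bounded n F -> bounded (flat_grading z n) (unflat x F).
Proof. by move=> hF i l; exact: hF. Qed.

Lemma unflat_surj (n : 'I_m -> nat) x f : (forall l, 0 < n l) ->
  bounded (flat_grading z n) f ->
  exists2 F, bounded n F & forall i l, i < size x -> unflat x F i l = f i l.
Proof.
(* With an empty lower row, the bijection on points concerns the single row [x]. *)
move=> n0 hf; have [g gK Kg] := @flat_point_bij m z x [::].
have [|F [G [hF _ e]]] := @lab_ext m _ _ n (fun a => lab f (fun _ _ => 0) (g a)) n0.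
  by move=> a; rewrite -{2}(Kg a); case: (g a) => [[i|[]//] l]; exact: hf.
exists F => // i l ix.
have := e (flat_point (inl (Ordinal ix), l)).
by rewrite lab_flat gK.
Qed.

Lemma unflat_pos x j k : j < size (flat_word z x) ->
  exists i l, i < size x /\ forall F, unflat x F i l = F j k.
Proof.
move=> jx; have [g _ Kg] := @flat_point_bij m z x [::].
have := Kg (inl (Ordinal jx), k); case: (g _) => [[i|[]//] l] e.
exists i, l; split=> // F.
by have := @lab_flat x [::] F F (inl i, l); rewrite e => /esym.
Qed.

Lemma unflat_cat x w F i l : i < size x -> unflat (x ++ w) F i l = unflat x F i l.
Proof. by move=> ix; rewrite /unflat nth_cat ix. Qed.

Lemma unflat_shift x w F i l :
  shift (size x) (unflat (x ++ w) F) i l = unflat w (shift (size (flat_word z x)) F) i l.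
Proof.
rewrite /unflat /shift nth_cat ltnNge leq_addr /= addKn size_flat_word.
by rewrite mulnDl -addnA.
Qed.

Lemma flat_word_cat x w : flat_word z (x ++ w) = flat_word z x ++ flat_word z w.
Proof. by rewrite /flat_word map_cat flatten_cat. Qed.

(** Each side asks for a middle labelling, one of the word [y] and one of its flattening;
    [unflat_surj] and [unflat_bounded] translate between them. *)
Lemma sp_flat_comp x y w (p : spart (m * d) y w) (q : spart (m * d) x y) :
  sp_flat z (sp_comp p q) = sp_comp (sp_flat z p) (sp_flat z q).
Proof.
apply: sp_rel_inj => F H hF hH; rewrite sp_rel_flat.
have hF' := unflat_bounded x hF; have hH' := unflat_bounded w hH.
apply/idP/idP.
  case/(sp_rel_comp2 _ _ hF' hH').
  move=> g [hg qg pg]; apply/(sp_rel_comp2 _ _ hF hH).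
  have [G hG eG] := @unflat_surj (fun=> 2) y _ (fun=> isT) hg; exists G.
  split=> //; rewrite sp_rel_flat.
    by rewrite (sp_rel_eq _ (f' := unflat x F) (g' := g)).
  by rewrite (sp_rel_eq _ (f' := g) (g' := unflat w H)).
case/(sp_rel_comp2 _ _ hF hH).
move=> G [hG]; rewrite !sp_rel_flat => qG pG.
apply/(sp_rel_comp2 _ _ hF' hH').
by exists (unflat y G); split=> //; exact: unflat_bounded hG.
Qed.

(** An identity of relations rather than of partitions, since the two partitions live over words
    that are not convertible. *)
Lemma sp_rel_flat_tensor x y w v (p : spart (m * d) x y) (q : spart (m * d) w v) F G :
  sp_rel (sp_tensor (sp_flat z p) (sp_flat z q)) F G =
  sp_rel (sp_flat z (sp_tensor p q)) F G.
Proof.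
rewrite sp_rel_flat !sp_rel_tensor !sp_rel_flat; congr (_ && _); apply: sp_rel_eq => i l h.
- by rewrite unflat_cat.
- by rewrite unflat_cat.
- by rewrite unflat_shift.
- by rewrite unflat_shift.
Qed.

Lemma sp_flat_star x y (p : spart (m * d) x y) :
  sp_flat z (sp_star p) = sp_star (sp_flat z p).
Proof. by apply: sp_rel_inj => F G _ _; rewrite sp_rel_star !sp_rel_flat sp_rel_star. Qed.

Lemma sp_flat_id x : sp_flat z (sp_id (m * d) x) = sp_id m (flat_word z x).
Proof.
apply: sp_rel_inj => F G _ _; rewrite sp_rel_flat; apply/idP/idP => /sp_rel_id h;
  apply/sp_rel_id => i l hi.
  by have [j [k [jx e]]] := unflat_pos l hi; rewrite -!e h.
rewrite /unflat; apply: h.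
have := ltn_ord (@flat_pos z x (Ordinal hi) (lev_copy l)).
by rewrite /= /letter (tnth_nth White) /=; case: nth.
Qed.

(** Used to unflatten the nested cup, and later because the spans describing Hom spaces of flattened
    words run over all of [C] between those words. *)
Lemma sp_flat_surj x y (q : spart m (flat_word z x) (flat_word z y)) :
  exists p : spart (m * d) x y, sp_flat z p = q.
Proof.
have fbij := @flat_point_bij m z x y; have [g fK gK] := fbij.
have gbij : bijective g by exists (@flat_point m z x y).
exists (SPart (partition_bij gbij (blocksP q))); apply: spart_inj => /=.
rewrite -imset_comp -[RHS]imset_id; apply: eq_imset => B /=.
by rewrite -imset_comp -[RHS]imset_id; apply: eq_imset => a /=; rewrite gK.
Qed.

Lemma sp_graded_flat (n : 'I_m -> nat) x y (p : spart (m * d) x y) :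
  sp_graded n (sp_flat z p) -> sp_graded (flat_grading z n) p.
Proof.
by move=> h B a b BP aB bB; apply: (h (@flat_point m z x y @: B) (flat_point a)
  (flat_point b)); rewrite ?imset_f.
Qed.

End Flat.

(** * Rigidity *)

Section Rigid.
Variable m : nat.
Implicit Types (c : colour) (x y w : word) (a b h : 'I_m -> nat).

Lemma sp_graded_imset (n : 'I_m -> nat) (T T' : finType) (f : T -> T') (P : {set {set T}})
    (l : T -> 'I_m) (l' : T' -> 'I_m) :
  (forall u, l' (f u) = l u) ->
  (forall (B : {set T}) u v, B \in P -> u \in B -> v \in B -> n (l u) = n (l v)) ->
  forall (B : {set T'}) u v, B \in [set [set f u | u in B] | B : {set T} in P] ->
  u \in B -> v \in B -> n (l' u) = n (l' v).
Proof.
move=> e h B a b /imsetP[B' BP ->] /imsetP[a' aB ->] /imsetP[b' bB ->].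
by rewrite !e; exact: (h B').
Qed.

Lemma sp_graded_star (n : 'I_m -> nat) x y (p : spart m x y) :
  sp_graded n p -> sp_graded n (sp_star p).
Proof. by move=> h; apply: sp_graded_imset h. Qed.

Lemma sp_graded_tensor (n : 'I_m -> nat) x y w z (p : spart m x y) (q : spart m w z) :
  sp_graded n p -> sp_graded n q -> sp_graded n (sp_tensor p q).
Proof.
move=> hp hq B a b; rewrite inE => /orP[].
  by move: B a b; apply: sp_graded_imset hp.
by move: B a b; apply: sp_graded_imset hq.
Qed.

Lemma sp_graded_id (n : 'I_m -> nat) x : sp_graded n (sp_id m x).
Proof.
by move=> B a b /imsetP[[i l] _ ->]; rewrite !inE => /orP[] /eqP -> /orP[] /eqP ->.
Qed.

Definition pair_lab a b : labelling m := fun i => if i is 0 then a else b.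

(** The upper row is empty, so its labelling is a dummy; for a word of two letters there remains a
    relation between the labels of the two legs. *)
Definition rel2 x (p : spart m [::] x) a b := sp_rel p (fun _ _ => 0) (pair_lab a b).

Lemma sp_rel2 c c' (p : spart m [::] [:: c; c']) f g :
  sp_rel p f g = rel2 p (g 0) (g 1).
Proof. by apply: sp_rel_eq => // -[|[|i]]. Qed.

Lemma eq_rel2 x (p : spart m [::] x) a a' b b' :
  a =1 a' -> b =1 b' -> rel2 p a b = rel2 p a' b'.
Proof. by move=> ea eb; apply: sp_rel_eq => // -[|i] l _ /=. Qed.

Definition snake c c' (r : spart m [::] [:: c; c']) (s : spart m [::] [:: c'; c]) :
    spart m [:: c] [:: c] :=
  sp_comp (sp_tensor (sp_star r) (sp_id m [:: c])) (sp_tensor (sp_id m [:: c]) s).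

(** The middle row carries three labels. The two identity strands force the outer ones to be [f 0]
    and [g 0], and the remaining label [h] composes the relation of [r] with that of [s]. *)
Lemma sp_rel_snake (n : 'I_m -> nat) c c' (r : spart m [::] [:: c; c'])
    (s : spart m [::] [:: c'; c]) f g :
  sp_graded n r -> sp_graded n s -> bounded n f -> bounded n g ->
  sp_rel (snake r s) f g <->
  exists h, [/\ forall l, h l < n l, rel2 r (f 0) h & rel2 s h (g 0)].
Proof.
move=> gr gs hf hg.
(* The existence of a bounded labelling already forces all bounds to be positive. *)
have n0 l : 0 < n l by apply: leq_trans (hf 0 l).
have grt : sp_graded n (sp_tensor (sp_star r) (sp_id m [:: c])).
  by apply: sp_graded_tensor; [exact: sp_graded_star|exact: sp_graded_id].
have gst : sp_graded n (sp_tensor (sp_id m [:: c]) s).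
  by apply: sp_graded_tensor => //; exact: sp_graded_id.
have -> := sp_rel_comp grt gst n0 hf hg; split.
  case=> k [hk]; rewrite (sp_rel_tensor (sp_id m [:: c]) s).
  rewrite (sp_rel_tensor (sp_star r)) sp_rel_star !sp_rel2.
  case/andP => /sp_rel_id e1 hs /andP[hr /sp_rel_id e2].
  exists (k 1); split=> //; first by rewrite (eq_rel2 r (a' := k 0) (b' := k 1)) // => l; apply: e1.
  rewrite (eq_rel2 s (a' := k 1) (b' := k 2)) // => l.
  by have := e2 0 l isT; rewrite /shift /=.
case=> h [hh hr hs].
exists (fun i => match i with 0 => f 0 | 1 => h | _ => g 0 end); split.
- by case=> [|[|i]] l; rewrite ?hf ?hg.
- by rewrite (sp_rel_tensor (sp_id m [:: c]) s) sp_rel2 andbC hs; apply/sp_rel_id => -[|].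
- by rewrite (sp_rel_tensor (sp_star r)) sp_rel_star sp_rel2 hr; apply/sp_rel_id => -[|].
Qed.

Lemma snake_rel (n : 'I_m -> nat) c c' (r : spart m [::] [:: c; c'])
    (s : spart m [::] [:: c'; c]) a b :
  sp_graded n r -> sp_graded n s -> snake r s = sp_id m [:: c] ->
  (forall l, a l < n l) -> (forall l, b l < n l) ->
  (exists h, [/\ forall l, h l < n l, rel2 r a h & rel2 s h b]) <-> a =1 b.
Proof.
move=> gr gs e ha hb.
have := sp_rel_snake gr gs (bounded_const ha) (bounded_const hb).
rewrite e /= => <-.
by split=> [/sp_rel_id h l|h]; [exact: (h 0)|apply/sp_rel_id => -[|i] l _].
Qed.

Lemma snake_eq c c' (r : spart m [::] [:: c; c']) (s : spart m [::] [:: c'; c]) :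
  (forall a b, (forall l, a l < 2) -> (forall l, b l < 2) ->
    (exists h, [/\ forall l, h l < 2, rel2 r a h & rel2 s h b]) <-> a =1 b) ->
  snake r s = sp_id m [:: c].
Proof.
move=> e; apply: sp_rel_inj => f g hf hg.
have E := @sp_rel_snake (fun=> 2) _ _ r s _ _ (fun _ _ _ _ _ _ => erefl)
  (fun _ _ _ _ _ _ => erefl) hf hg.
apply/idP/idP.
  by move/E/e => h; apply/sp_rel_id => -[|i] l // _; apply: h => k; [exact: hf|exact: hg].
move=> /sp_rel_id h; apply/E/e => [l|l|l]; [exact: hf|exact: hg|exact: h].
Qed.

End Rigid.

(** * Rigidity of the flattened category *)

Section FlatRigid.
Variables (m : nat) (C : spart_family m).
Hypotheses (Ccat : is_category C) (Crig : is_rigid C).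

Lemma flat_preimage_category : is_category (flat_preimage wb C).
Proof.
have [Ccomp Ctens Cstar CW CB] := Ccat.
(* Both colours flatten to [wb], so this one identity accounts for the white and the black one. It
   is compared through relations with the tensor product of the two one-letter identities. *)
have Cid : C (sp_id m wb).
  have := Ctens _ _ _ _ _ _ CW CB; apply: (@family_cast _ C) => // f g _ _.
  rewrite sp_rel_tensor; apply/andP/idP => [[/sp_rel_id h1 /sp_rel_id h2]|/sp_rel_id h].
    apply/sp_rel_id => -[|[|i]] l // _; [exact: h1|exact: (h2 0)].
  split; apply/sp_rel_id => -[|i] l // _; [exact: h|exact: (h 1)].
split.
- by move=> x y z p q; rewrite /flat_preimage sp_flat_comp; exact: Ccomp.
- move=> x y w z p q hp hq; have := Ctens _ _ _ _ _ _ hp hq.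
  apply: family_cast => [||f g _ _]; rewrite ?flat_word_cat //.
  exact: sp_rel_flat_tensor.
- by move=> x y p; rewrite /flat_preimage sp_flat_star; exact: Cstar.
- by rewrite /flat_preimage sp_flat_id.
- by rewrite /flat_preimage sp_flat_id.
Qed.

Definition half_lab (c : 'I_2) (a : 'I_(m * 2) -> nat) : 'I_m -> nat :=
  fun k => a (@lev m wb k c).

Definition join_lab (a b : 'I_m -> nat) : 'I_(m * 2) -> nat := fun l =>
  if @lev_copy m wb l == ord0 then a (@lev_base m wb l) else b (@lev_base m wb l).

Lemma half0_join a b : half_lab ord0 (join_lab a b) =1 a.
Proof. by move=> k; rewrite /half_lab /join_lab (@lev_copy_lev m wb) (@lev_base_lev m wb). Qed.

Lemma half1_join a b : half_lab ord_max (join_lab a b) =1 b.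
Proof. by move=> k; rewrite /half_lab /join_lab (@lev_copy_lev m wb) (@lev_base_lev m wb). Qed.

Lemma half_lab_eq a b : half_lab ord0 a =1 half_lab ord0 b ->
  half_lab ord_max a =1 half_lab ord_max b ->
  a =1 b.
Proof.
move=> h0 h1 l; rewrite -(@levK m wb l).
case: (@lev_copy m wb l) => -[|[|//]] hc.
  by rewrite (_ : Ordinal hc = ord0); [exact: h0|exact: val_inj].
by rewrite (_ : Ordinal hc = ord_max); [exact: h1|exact: val_inj].
Qed.

(** The nested cup joins positions 0, 3 by [r] and 1, 2 by [s]. Read over white-black, these are the
    copies 0 and the copies 1 of the levels; read over black-white, the order of copies is reversed
    at each letter, and [r] joins the copies 1, [s] the copies 0. Each snake therefore splits into a
    snake of [r] with [s] on one copy and a snake of [s] with [r] on the other. *)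
Lemma flat_preimage_rigid : is_rigid (flat_preimage wb C).
Proof.
have [Ccomp Ctens Cstar CW CB] := Ccat.
have [r [s [Cr Cs e1 e2]]] := Crig.
have {}e1 := fun a b ha hb => @snake_rel m (fun=> 2) _ _ r s a b
  (fun _ _ _ _ _ _ => erefl) (fun _ _ _ _ _ _ => erefl) e1 ha hb.
have {}e2 := fun a b ha hb => @snake_rel m (fun=> 2) _ _ s r a b
  (fun _ _ _ _ _ _ => erefl) (fun _ _ _ _ _ _ => erefl) e2 ha hb.
pose idW := sp_id m [:: White]; pose idB := sp_id m [:: Black].
pose R0 : spart m [::] [:: White; Black; White; Black] :=
  sp_comp (sp_tensor (sp_tensor idW s) idB) r.
have CR0 : C R0 := Ccomp _ _ _ _ _ (Ctens _ _ _ _ _ _ (Ctens _ _ _ _ _ _ CW Cs) CB) Cr.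
have R0E f g : bounded (fun=> 2) f -> bounded (fun=> 2) g ->
    sp_rel R0 f g = rel2 r (g 0) (g 3) && rel2 s (g 1) (g 2).
  move=> hf hg.
  have E := sp_rel_comp2 (sp_tensor (sp_tensor idW s) idB) r hf hg.
  apply/idP/idP.
    case/E => h [_]; rewrite (sp_rel_tensor (sp_tensor idW s) idB) (sp_rel_tensor idW s).
    rewrite !sp_rel2 => hr.
    case/andP => /andP[/sp_rel_id h0 hs] /sp_rel_id h1.
    apply/andP; split=> //; rewrite -(eq_rel2 r (a := h 0) (b := h 1)) // => l.
      exact: h0.
    exact: (h1 0).
  case/andP => hr hs; apply/E; exists (pair_lab (g 0) (g 3)); split.
  - by case=> [|i] l; apply: hg.
  - by rewrite sp_rel2.
  - rewrite !sp_rel_tensor sp_rel2 hs andbT.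
    by apply/andP; split; apply/sp_rel_id => -[|i].
have [r' r'E] := @sp_flat_surj m wb [::] [:: White; Black] R0.
have [s' s'E] := @sp_flat_surj m wb [::] [:: Black; White] R0.
have r'rel a b : (forall l, a l < 2) -> (forall l, b l < 2) -> rel2 r' a b =
    rel2 r (half_lab ord0 a) (half_lab ord0 b) &&
    rel2 s (half_lab ord_max a) (half_lab ord_max b).
  move=> ha hb.
  have bab : bounded (flat_grading wb (fun=> 2)) (pair_lab a b) by case=> [|i] l /=.
  have [G hG eG] := @unflat_surj _ wb (fun=> 2) [:: White; Black] _ (fun=> isT) bab.
  have := @sp_rel_flat m wb _ _ r' (fun _ _ => 0) G; rewrite r'E R0E // => e.
  rewrite /rel2 (sp_rel_eq r' (f' := unflat [::] (fun _ _ => 0)) (g' := unflat wb G)) //;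
    last by move=> i l hi; rewrite eG.
  have GE i k (c : 'I_2) : i < 2 ->
      G (i * 2 + (if nth White wb i is White then c : nat else 2 - c.+1)) k =
      half_lab c (pair_lab a b i) k by move=> hi; rewrite /half_lab -eG // unflat_lev.
  rewrite -e; congr (_ && _); apply: eq_rel2 => k.
  - by rewrite -(GE 0 k ord0 isT).
  - by rewrite -(GE 1 k ord0 isT).
  - by rewrite -(GE 0 k ord_max isT).
  - by rewrite -(GE 1 k ord_max isT).
have s'rel a b : (forall l, a l < 2) -> (forall l, b l < 2) -> rel2 s' a b =
    rel2 r (half_lab ord_max a) (half_lab ord_max b) &&
    rel2 s (half_lab ord0 a) (half_lab ord0 b).
  move=> ha hb.
  have bab : bounded (flat_grading wb (fun=> 2)) (pair_lab a b) by case=> [|i] l /=.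
  have [G hG eG] := @unflat_surj _ wb (fun=> 2) [:: Black; White] _ (fun=> isT) bab.
  have := @sp_rel_flat m wb _ _ s' (fun _ _ => 0) G; rewrite s'E R0E // => e.
  rewrite /rel2 (sp_rel_eq s' (f' := unflat [::] (fun _ _ => 0))
    (g' := unflat [:: Black; White] G)) //; last by move=> i l hi; rewrite eG.
  have GE i k (c : 'I_2) : i < 2 ->
      G (i * 2 + (if nth White [:: Black; White] i is White then c : nat else 2 - c.+1)) k =
      half_lab c (pair_lab a b i) k by move=> hi; rewrite /half_lab -eG // unflat_lev.
  rewrite -e; congr (_ && _); apply: eq_rel2 => k.
  - by rewrite -(GE 0 k ord_max isT).
  - by rewrite -(GE 1 k ord_max isT).
  - by rewrite -(GE 0 k ord0 isT).
  - by rewrite -(GE 1 k ord0 isT).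
have hjoin a b : (forall l, a l < 2) -> (forall l, b l < 2) -> forall l, join_lab a b l < 2.
  by move=> ha hb l; rewrite /join_lab; case: ifP.
have hhalf c a : (forall l, a l < 2) -> forall k, half_lab c a k < 2 by move=> ha k; exact: ha.
exists r', s'; split.
- by rewrite /flat_preimage r'E.
- by rewrite /flat_preimage s'E.
- apply: snake_eq => a b ha hb; split.
    case=> h [hh]; rewrite r'rel // s'rel // => /andP[r0 s1] /andP[r1 s0].
    apply: half_lab_eq.
      by apply/e1; [exact: hhalf|exact: hhalf|
        exists (half_lab ord0 h); split=> //; exact: hhalf].
    by apply/e2; [exact: hhalf|exact: hhalf|
        exists (half_lab ord_max h); split=> //; exact: hhalf].
  move=> eab; have eh c : half_lab c a =1 half_lab c b by move=> k; exact: eab.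
  have [h0 [hh0 r0 s0]] := (e1 _ _ (hhalf ord0 _ ha) (hhalf ord0 _ hb)).2 (eh ord0).
  have [h1 [hh1 s1 r1]] := (e2 _ _ (hhalf ord_max _ ha) (hhalf ord_max _ hb)).2 (eh ord_max).
  exists (join_lab h0 h1); split; first exact: hjoin.
    rewrite r'rel //; last exact: hjoin.
    by rewrite (eq_rel2 r (frefl _) (@half0_join h0 h1))
      (eq_rel2 s (frefl _) (@half1_join h0 h1)) r0 s1.
  rewrite s'rel //; last exact: hjoin.
  by rewrite (eq_rel2 r (@half1_join h0 h1) (frefl _))
    (eq_rel2 s (@half0_join h0 h1) (frefl _)) r1 s0.
- apply: snake_eq => a b ha hb; split.
    case=> h [hh]; rewrite r'rel // s'rel // => /andP[r0 s1] /andP[r1 s0].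
    apply: half_lab_eq.
      by apply/e2; [exact: hhalf|exact: hhalf|
        exists (half_lab ord0 h); split=> //; exact: hhalf].
    by apply/e1; [exact: hhalf|exact: hhalf|
        exists (half_lab ord_max h); split=> //; exact: hhalf].
  move=> eab; have eh c : half_lab c a =1 half_lab c b by move=> k; exact: eab.
  have [h0 [hh0 s0 r0]] := (e2 _ _ (hhalf ord0 _ ha) (hhalf ord0 _ hb)).2 (eh ord0).
  have [h1 [hh1 r1 s1]] := (e1 _ _ (hhalf ord_max _ ha) (hhalf ord_max _ hb)).2 (eh ord_max).
  exists (join_lab h0 h1); split; first exact: hjoin.
    rewrite s'rel //; last exact: hjoin.
    by rewrite (eq_rel2 s (frefl _) (@half0_join h0 h1))
      (eq_rel2 r (frefl _) (@half1_join h0 h1)) r1 s0.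
  rewrite r'rel //; last exact: hjoin.
  by rewrite (eq_rel2 s (@half1_join h0 h1) (frefl _))
    (eq_rel2 r (@half0_join h0 h1) (frefl _)) r0 s1.
Qed.

End FlatRigid.

From mathcomp Require Import all_classical all_analysis.
From mathcomp Require Import complex ring lra.

Import Order.TTheory GRing.Theory Num.Theory.
Import numFieldNormedType.Exports.
Local Open Scope ring_scope.
Local Open Scope classical_set_scope.

(** * Norms and continuity *)

(** Positivity in [R[i]] includes being real, so balls of real radius suffice. *)
Lemma gt0_complexP (R : realType) (e : R[i]) : 0 < e -> exists2 r : R, 0 < r & e = r%:C%C.
Proof.
move=> e0; have /complex_realP[r er] : e \is Num.real by exact: gtr0_real.
by exists r => //; rewrite -ltcR -er.
Qed.

Section NormedSpaces.
Variables (R : realType) (V : normedModType R[i]).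
Implicit Types (x y : V) (E : set V).

(** The norm has values in [R[i]]; this is the same number in [R], where the order is total and
    [lra] applies. *)
Definition rnorm x : R := complex.Re `|x|.

Lemma rnormE x : `|x| = (rnorm x)%:C%C.
Proof. by rewrite /rnorm RRe_real // normr_real. Qed.

Lemma ball_rnorm x (e : R) y : ball x e%:C%C y <-> rnorm (x - y) < e.
Proof. by rewrite -ball_normE /ball_ /= rnormE ltcR. Qed.

Lemma closure_rnorm E x :
  closure E x <-> forall e : R, 0 < e -> exists2 y, E y & rnorm (x - y) < e.
Proof.
split=> [cl e e0|h B].
  have e0' : 0 < e%:C%C :> R[i] by rewrite ltcR.
  have [y [Ey /ball_rnorm]] := cl _ (nbhsx_ballx x _ e0'); by exists y.
move/nbhs_ballP => [e /= /gt0_complexP[r r0 ->] hB]; have [y Ey xy] := h _ r0.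
by exists y; split=> //; apply: hB; apply/ball_rnorm.
Qed.

Lemma closed_rnorm E : closed E <->
  forall x, (forall e : R, 0 < e -> exists2 y, E y & rnorm (x - y) < e) -> E x.
Proof.
split=> h x; first by move/closure_rnorm/h.
by move/closure_rnorm/h.
Qed.

End NormedSpaces.

(** Completeness is a hypothesis on filters, the form in which [cstarAlg] provides it; the limit is
    returned with explicit tolerances, the form in which the later estimates use it. *)
Lemma cauchy_geometric (R : realType) (V : normedModType R[i]) (u : nat -> V) :
  (forall F : set_system V, ProperFilter F -> cauchy F -> cvg F) ->
  (forall k, rnorm (u k.+1 - u k) <= 2^-1 ^+ k) ->
  exists l, forall e : R, 0 < e -> exists N, forall k, (N <= k)%N -> rnorm (l - u k) < e.
Proof.
move=> complV hu.
have rD (x y : V) : rnorm (x + y) <= rnorm x + rnorm y.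
  by rewrite -lecR rmorphD /= -!rnormE ler_normD.
(* The subtracted term carries the induction: from [k] to [k.+1] it decreases by exactly the bound
   on the new increment. *)
have tail N k : rnorm (u (N + k)%N - u N) <= 2 * 2^-1 ^+ N - 2 * 2^-1 ^+ (N + k).
  elim: k => [|k IH]; first by rewrite addn0 !subrr /rnorm normr0.
  have -> : u (N + k.+1)%N - u N = (u (N + k).+1 - u (N + k)%N) + (u (N + k)%N - u N).
    by rewrite addnS addrA subrK.
  apply: le_trans (rD _ _) _; apply: le_trans (lerD (hu _) IH) _.
  by rewrite addnS [_ ^+ _.+1]exprS; lra.
have small (e : R) : 0 < e -> exists N, 2 * 2^-1 ^+ N < e.
  move=> e0; have [N hN] : exists N : nat, 2 / e < N%:R.
    by exists (Num.bound (2 / e));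
      apply: le_lt_trans (archi_boundP _); rewrite ?ler_norm ?divr_ge0 // ltW.
  exists N; rewrite exprVn; have : N%:R < 2 ^+ N :> R by rewrite -natrX ltr_nat ltn_expl.
  move=> /(lt_trans hN); rewrite ltr_pdivrMr // mulrC => h.
  by rewrite ltr_pdivrMr ?exprn_gt0 // mulrC.
have tail' N k : (N <= k)%N -> rnorm (u k - u N) <= 2 * 2^-1 ^+ N.
  move=> /subnKC <-; apply: le_trans (tail _ _) _.
  by rewrite gerBl mulr_ge0 // exprn_ge0.
have rC (x y : V) : rnorm (x - y) = rnorm (y - x) by rewrite /rnorm distrC.
have : cvg (u @ \oo).
  apply: complV; apply/cauchy_ballP => e /gt0_complexP[r r0 ->].
  have [N hN] := small (r / 2) (divr_gt0 r0 (ltr0Sn _ 1)).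
  exists ([set u k | k in [set k | (N <= k)%N]], [set u k | k in [set k | (N <= k)%N]]) => /=.
    by split; exists N => // k Nk; exists k.
  move=> _ /= [[j Nj <-] [k Nk <-]]; apply/ball_rnorm.
  have -> : u j - u k = (u j - u N) + (u N - u k) by rewrite addrA subrK.
  apply: le_lt_trans (rD _ _) _; rewrite [X in _ + X]rC.
  by have := tail' _ _ Nj; have := tail' _ _ Nk; lra.
move=> /cvg_ex[l /cvg_ballP hl]; exists l => e e0.
have /hl[N _ hN] : 0 < e%:C%C :> R[i] by rewrite ltcR.
by exists N => k Nk; apply/ball_rnorm; apply: hN.
Qed.

(** * Real-valued norms and square roots in a C*-algebra *)

Definition anorm (R : realType) (A : normedAlg R) (a : A) : R := complex.Re (nalg_norm a).

Section StarAlgebra.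
Variables (R : realType) (A : cstarAlg R).
Implicit Types (a b : A) (E : set A).

Lemma anormE a : nalg_norm a = (anorm a)%:C%C.
Proof. exact: (rnormE (a : nalg_space A)). Qed.

Lemma anorm_ge0 a : 0 <= anorm a.
Proof. by rewrite -lecR -anormE; exact: (normr_ge0 (a : nalg_space A)). Qed.

Lemma anormD a b : anorm (a + b) <= anorm a + anorm b.
Proof. by rewrite -lecR rmorphD /= -!anormE nalg_normD. Qed.

Lemma anormM a b : anorm (a * b) <= anorm a * anorm b.
Proof. by rewrite -lecR rmorphM /= -!anormE nalg_normM. Qed.

Lemma anormZ (k : R[i]) a : anorm (k *: a) = complex.Re `|k| * anorm a.
Proof.
by rewrite /anorm nalg_normZ anormE -[`|k|]RRe_real ?normr_real //= mulr0 subr0.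
Qed.

Lemma anorm0 : anorm (0 : A) = 0.
Proof. by rewrite -[0 in LHS](scale0r 1) anormZ normr0 mul0r. Qed.

Lemma anormN a : anorm (- a) = anorm a.
Proof. by rewrite -scaleN1r anormZ normrN1 mul1r. Qed.

Lemma anormB a b : anorm (a - b) <= anorm a + anorm b.
Proof. by rewrite -(anormN b) anormD. Qed.

Lemma anorm_half a : anorm (2^-1 *: a) = 2^-1 * anorm a.
Proof.
by rewrite anormZ ger0_norm ?invr_ge0 // -(rmorph_nat (real_complex R)) -fmorphV.
Qed.

Lemma halfD : 2^-1 + 2^-1 = 1 :> R[i].
Proof. by rewrite -[2^-1]mulr1 -mulrDr mulVf. Qed.

Lemma anorm_eq0 a : anorm a = 0 -> a = 0.
Proof. by move=> a0; apply: nalg_norm_eq0; rewrite anormE a0. Qed.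

Lemma star0 : star (0 : A) = 0.
Proof. by apply: (addrI (star 0)); rewrite -starD !addr0. Qed.

Lemma starN a : star (- a) = - star a.
Proof. by apply: (addrI (star a)); rewrite -starD !subrr star0. Qed.

Lemma starB a b : star (a - b) = star a - star b.
Proof. by rewrite starD starN. Qed.

Lemma star1 : star (1 : A) = 1.
Proof. by rewrite -[RHS]starK -[star 1 in RHS]mulr1 starM starK mulr1. Qed.

Lemma star_sum (I : finType) (F : I -> A) : star (\sum_i F i) = \sum_i star (F i).
Proof. exact: (big_morph (@star R A) (@starD R A) star0). Qed.

Lemma anorm_cstar a : anorm (star a * a) = anorm a ^+ 2.
Proof. by apply: complexI; rewrite rmorphXn /= -!anormE cstar_norm. Qed.

Lemma anorm_star a : anorm (star a) = anorm a.
Proof.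
suff le b : anorm b <= anorm (star b).
  by apply/le_anti; rewrite le andbT -{2}(starK a) le.
have [b0|b0] := eqVneq (anorm b) 0; first by rewrite b0 anorm_ge0.
have := anormM (star b) b; rewrite anorm_cstar expr2 ler_pM2r //.
by rewrite lt0r b0 anorm_ge0.
Qed.

Lemma anorm1 : anorm (1 : A) = 1.
Proof.
have := anorm_cstar 1; rewrite star1 mulr1 => /esym/eqP.
rewrite expr2 -subr_eq0 -[X in _ - X]mulr1 -mulrBr mulf_eq0 => /orP[/eqP/anorm_eq0/eqP|].
  by rewrite oner_eq0.
by rewrite subr_eq0 => /eqP.
Qed.

Lemma anorm_isometry (w : A) : star w * w = 1 -> anorm w = 1.
Proof.
move=> ww; have := anorm_cstar w; rewrite ww anorm1 => /esym/eqP.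
by rewrite sqrf_eq1 => /orP[/eqP //|/eqP h]; have := anorm_ge0 w; rewrite h oppr_ge0 ler10.
Qed.

Lemma closed_anorm E : closed (E : set (nalg_space A)) <->
  forall a, (forall e : R, 0 < e -> exists2 b, E b & anorm (a - b) < e) -> E a.
Proof. exact: (@closed_rnorm R (nalg_space A)). Qed.

Lemma closure_anorm E a : closure (E : set (nalg_space A)) a <->
  forall e : R, 0 < e -> exists2 b, E b & anorm (a - b) < e.
Proof. exact: (@closure_rnorm R (nalg_space A)). Qed.

Lemma anorm_small_eq0 a (M : R) : 0 <= M -> (forall e, 0 < e -> anorm a <= M * e) -> a = 0.
Proof.
move=> M0 h; apply: anorm_eq0; apply/le_anti; rewrite anorm_ge0 andbT.
apply/ler_addgt0Pr => e e0; rewrite add0r.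
have M1 : 0 < M + 1 by rewrite ltr_wpDl.
apply: (le_trans (h (e / (M + 1)) (divr_gt0 e0 M1))).
by rewrite mulrCA ler_piMr ?ltW // ltr_pdivrMr // mul1r ltrDl.
Qed.

(* The fixed point y of y |-> (c + y^2)/2, a contraction of the ball of radius 1/4,
   satisfies (1 - y)^2 = 1 - c. *)
Lemma sqrt_one_minus (c : A) : anorm c <= 4^-1 -> star c = c ->
  exists b, [/\ star b = b, b * b = 1 - c & forall a, a * c = c * a -> a * b = b * a].
Proof.
move=> hc sc; pose y k : A := iter k (fun y => 2^-1 *: (c + y * y)) 0.
have yS k : y k.+1 = 2^-1 *: (c + y k * y k) by [].
have y4 k : anorm (y k) <= 4^-1.
  elim: k => [|k IH]; first by rewrite anorm0 invr_ge0.
  have h : anorm (y k) * anorm (y k) <= 4^-1 * 4^-1 by rewrite ler_pM ?anorm_ge0.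
  rewrite yS anorm_half; have := anormD c (y k * y k); have := anormM (y k) (y k).
  by clear -hc h; lra.
have sqB (u v : A) : u * u - v * v = u * (u - v) + (u - v) * v.
  by rewrite mulrBr mulrBl addrA subrK.
have sqB_norm (u v : A) : anorm (u * u - v * v) <= (anorm u + anorm v) * anorm (u - v).
  rewrite sqB [leRHS]mulrDl; apply: le_trans (anormD _ _) _; apply: lerD; first exact: anormM.
  by rewrite [leRHS]mulrC anormM.
have yd k : anorm (y k.+1 - y k) <= 2^-1 ^+ k.
  elim: k => [|k IH].
    by rewrite expr0 subr0; apply: le_trans (y4 1) _; rewrite invf_le1 // ler1n.
  have -> : y k.+2 - y k.+1 = 2^-1 *: (y k.+1 * y k.+1 - y k * y k).
    by rewrite [in LHS]yS [in X in _ - X]yS -scalerBr opprD addrACA subrr add0r.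
  rewrite anorm_half exprS; apply: ler_pM => //.
    exact: anorm_ge0.
  apply: le_trans (sqB_norm _ _) _; rewrite -[leRHS]mul1r.
  apply: ler_pM => //; rewrite ?addr_ge0 ?anorm_ge0 //.
  by have := y4 k; have := y4 k.+1; clear; lra.
have [l hl] := @cauchy_geometric R (nalg_space A) y (@cstar_complete R A) yd.
have {}hl e : 0 < e -> exists k, anorm (l - y k) < e /\ anorm (l - y k.+1) < e.
  by move=> /hl[N hN]; exists N; split; apply: hN.
(* This replaces passing to the limit: an expression in [l] bounded by a multiple of the distances
   from [l] to two consecutive iterates vanishes. Two iterates are needed because the fixed point
   equation links [y k] to [y k.+1]. *)
have fixE (f : A -> A) (M : R) : 0 <= M ->
    (forall k, anorm (f l) <= M * (anorm (l - y k) + anorm (l - y k.+1))) -> f l = 0.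
  move=> M0 h; apply: (@anorm_small_eq0 _ (2 * M)); first by rewrite mulr_ge0.
  move=> e /hl[k [h1 h2]]; apply: le_trans (h k) _.
  rewrite [2 * M]mulrC -mulrA ler_wpM2l //; clear -h1 h2; lra.
have sy k : star (y k) = y k.
  elim: k => [|k IH]; first exact: star0.
  by rewrite yS starZ starD starM IH sc geC0_conj // invr_ge0.
have sl : star l = l.
  apply/eqP; rewrite -subr_eq0; apply/eqP; apply: (fixE (fun x => star x - x) 2) => // k.
  have -> : star l - l = star (l - y k) - (l - y k).
    by rewrite starB sy opprB addrA addrNK.
  have := anormB (star (l - y k)) (l - y k); rewrite anorm_star.
  by have := anorm_ge0 (l - y k.+1); have := anorm_ge0 (l - y k); clear; lra.
have cl a : a * c = c * a -> a * l = l * a.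
  move=> ac; have ay k : a * y k = y k * a.
    elim: k => [|k IH]; first by rewrite mulr0 mul0r.
    by rewrite yS -scalerAr -scalerAl mulrDr mulrDl ac mulrA IH -!mulrA IH.
  apply/eqP; rewrite -subr_eq0; apply/eqP.
  apply: (fixE (fun x => a * x - x * a) (2 * anorm a)) => [|k].
    by rewrite mulr_ge0 // anorm_ge0.
  have -> : a * l - l * a = a * (l - y k) - (l - y k) * a.
    by rewrite mulrBr mulrBl ay opprB addrA addrNK.
  have := anormB (a * (l - y k)) ((l - y k) * a).
  have := anormM a (l - y k); have := anormM (l - y k) a.
  have := mulr_ge0 (anorm_ge0 a) (anorm_ge0 (l - y k.+1)).
  have := mulr_ge0 (anorm_ge0 a) (anorm_ge0 (l - y k)).
  by clear; rewrite [_ (l - y k) * _ a]mulrC !mulrDr; lra.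
have fl : l + l = c + l * l.
  suff h : 2^-1 *: (c + l * l) - l = 0.
    have {}h : l = 2^-1 *: (c + l * l) by apply/esym/eqP; rewrite -subr_eq0 h.
    by rewrite {1 2}h -scalerDl halfD scale1r.
  apply: (fixE (fun x => 2^-1 *: (c + x * x) - x) (anorm l + 2)) => [|k].
    by rewrite addr_ge0 // anorm_ge0.
  have -> : 2^-1 *: (c + l * l) - l = 2^-1 *: (l * l - y k * y k) - (l - y k.+1).
    by rewrite yS opprB addrA -scalerDr [_ - _ + _]addrC addrACA addrN addr0.
  have := anormB (2^-1 *: (l * l - y k * y k)) (l - y k.+1); rewrite anorm_half.
  have h1 := sqB_norm l (y k).
  have h2 : (anorm l + anorm (y k)) * anorm (l - y k) <= (anorm l + 1) * anorm (l - y k).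
    rewrite ler_wpM2r ?anorm_ge0 // lerD2l; apply: le_trans (y4 k) _.
    by rewrite invf_le1 // ler1n.
  have := mulr_ge0 (anorm_ge0 l) (anorm_ge0 (l - y k.+1)).
  have := mulr_ge0 (anorm_ge0 l) (anorm_ge0 (l - y k)).
  have := anorm_ge0 (l - y k.+1); have := anorm_ge0 (l - y k).
  by move: h1 h2; clear; rewrite !mulrDl !mulrDr; lra.
exists (1 - l); split.
- by rewrite starB star1 sl.
- have cE : c = l + l - l * l by rewrite fl addrK.
  by rewrite mulrBr mulr1 mulrBl mul1r cE !opprB opprD -addrA [- l + _]addrCA.
- by move=> a /cl al; rewrite mulrBr mulrBl mulr1 mul1r al.
Qed.

Lemma unitary_half_sum (a : A) : star a = a -> anorm a <= 2^-1 ->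
  exists2 w, star w * w = 1 & a = 2^-1 *: (w + star w).
Proof.
move=> sa na; have [||b [sb bb cb]] := @sqrt_one_minus (a * a).
- apply: le_trans (anormM _ _) _; rewrite (_ : 4^-1 = 2^-1 * 2^-1); last by field.
  by rewrite ler_pM ?anorm_ge0.
- by rewrite starM sa.
(* The root commutes with [a] since [a] commutes with its square; this removes the cross term i(ab -
   ba) from w^* w. *)
have ab : a * b = b * a by apply: cb; rewrite mulrA.
have starE : star (a + 'i *: b) = a - 'i *: b by rewrite starD starZ sa sb conjCi scaleNr.
have ii : 'i *: b * ('i *: b) = a * a - 1 :> A.
  by rewrite -scalerAl -scalerAr scalerA -expr2 sqrCi bb scaleN1r opprB.
have ibC : 'i *: b * a = a * ('i *: b) by rewrite -scalerAl -scalerAr ab.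
exists (a + 'i *: b); rewrite starE.
  by rewrite mulrDr !mulrBl ibC ii; rewrite addrA addrNK opprB addrC subrK.
by rewrite addrACA addrN addr0 scalerDr -scalerDl halfD scale1r.
Qed.
End StarAlgebra.

(** * Continuity of star-morphisms *)

Section StarMorphism.
Variables (R : realType) (A B : cstarAlg R) (f : {lrmorphism A -> B}).
Hypothesis fstar : is_star_morphism f.

(** A self-adjoint element of norm at most 1/2 is a half-sum of elements sent to isometries and
    their adjoints, so its image has norm at most 1. Rescaling to norm 1/2 produces the constant 2,
    and the C*-identity applied to [star a * a] extends the bound to all [a]. Any constant would
    give continuity. *)
Lemma star_morphism_norm a : anorm (f a) <= 2 * anorm a.
Proof.
have small b : star b = b -> anorm b <= 2^-1 -> anorm (f b) <= 1.
  move=> sb nb; have [w ww ->] := unitary_half_sum sb nb.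
  have fw : star (f w) * f w = 1 by rewrite -fstar -rmorphM ww rmorph1.
  rewrite linearZ rmorphD /= fstar anorm_half; have := anormD (f w) (star (f w)).
  by rewrite anorm_star (anorm_isometry fw); lra.
have sadj b : star b = b -> anorm (f b) <= 2 * anorm b.
  move=> sb; have [b0|b0] := eqVneq (anorm b) 0.
    by rewrite (anorm_eq0 b0) raddf0 !anorm0 mulr0.
  have {}b0 : 0 < anorm b by rewrite lt0r b0 anorm_ge0.
  pose t := (2 * anorm b)^-1.
  have t0 : 0 < t by rewrite invr_gt0 mulr_gt0.
  have nt (D : cstarAlg R) (d : D) : anorm (t%:C%C *: d) = t * anorm d.
    by rewrite anormZ ger0_norm ?lecR ?ltW.
  have stb : star (t%:C%C *: b) = t%:C%C *: b.
    by rewrite starZ sb geC0_conj // ler0c ltW.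
  have := small _ stb; rewrite linearZ !nt => h.
  have {}h : t * anorm (f b) <= 1.
    by apply: h; rewrite /t invfM -mulrA mulVf ?mulr1 // gt_eqF.
  by rewrite ler_pdivrMl ?mulr_gt0 // mulr1 in h.
have := sadj (star a * a); rewrite starM starK rmorphM /= fstar !anorm_cstar => /(_ erefl) h.
have : anorm (f a) ^+ 2 <= (2 * anorm a) ^+ 2.
  by apply: le_trans h _; rewrite exprMn ler_wpM2r ?exprn_ge0 ?anorm_ge0 // -natrX ler_nat.
by rewrite ler_pXn2r // nnegrE ?mulr_ge0 ?anorm_ge0.
Qed.
End StarMorphism.

(** * Closures and generated C*-subalgebras *)

Section Subalgebras.
Variables (R : realType) (A : cstarAlg R).
Implicit Types (a b : A).

Lemma small_factor (M e : R) : 0 <= M -> 0 < e ->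
  exists2 d, 0 < d & forall x, 0 <= x -> x < d -> M * x < e.
Proof.
move=> M0 e0; have M1 : 0 < M + 1 by rewrite ltr_wpDl.
exists (e / (M + 1)); first exact: divr_gt0.
move=> x x0; rewrite ltr_pdivlMr // mulrC => h; apply: le_lt_trans h.
by rewrite ler_wpM2r // lerDl.
Qed.

Lemma closure_cstar_subalg (L : set A) :
  L 1 -> (forall (k : R[i]) a b, L a -> L b -> L (k *: a + b)) ->
  (forall a b, L a -> L b -> L (a * b)) -> (forall a, L a -> L (star a)) ->
  is_cstar_subalg (closure (L : set (nalg_space A))).
Proof.
move=> L1 Llin LM Ls; split.
- exact: closed_closure.
- exact: subset_closure.
- move=> k a b /closure_anorm ha /closure_anorm hb; apply/closure_anorm => e e0.
  have e2 : 0 < e / 2 by rewrite divr_gt0.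
  have k0 : 0 <= complex.Re `|k| by rewrite -lecR RRe_real ?normr_real ?normr_ge0.
  have [d d0 hd] := small_factor k0 e2.
  have [a' La' aa'] := ha _ d0; have [b' Lb' bb'] := hb _ e2.
  exists (k *: a' + b'); first exact: Llin.
  rewrite opprD addrACA -scalerBr; apply: le_lt_trans (anormD _ _) _.
  by rewrite anormZ [e]splitr; apply: ltrD => //; apply: hd => //; exact: anorm_ge0.
- move=> a b /closure_anorm ha /closure_anorm hb; apply/closure_anorm => e e0.
  have e2 : 0 < e / 2 by rewrite divr_gt0.
  have [d d0 hd] := small_factor (anorm_ge0 a) e2.
  (* [b'] is chosen first, because the tolerance for [a'] depends on its norm. *)
  have [b' Lb' bb'] := hb _ d0.
  have [d' d'0 hd'] := small_factor (anorm_ge0 b') e2.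
  have [a' La' aa'] := ha _ d'0.
  exists (a' * b'); first exact: LM.
  have -> : a * b - a' * b' = a * (b - b') + (a - a') * b'.
    by rewrite mulrBr mulrBl addrA subrK.
  apply: le_lt_trans (anormD _ _) _; rewrite [e]splitr; apply: ltrD.
    by apply: le_lt_trans (anormM _ _) _; apply: hd => //; exact: anorm_ge0.
  apply: le_lt_trans (anormM _ _) _; rewrite mulrC.
  by apply: hd' => //; exact: anorm_ge0.
- move=> a /closure_anorm ha; apply/closure_anorm => e e0.
  have [a' La' aa'] := ha _ e0; exists (star a'); first exact: Ls.
  by rewrite -starB anorm_star.
Qed.

Variable S : set A.

Lemma cstar_gen_sub a : S a -> cstar_gen S a.
Proof. by move=> Sa; apply: sub_gen_smallest. Qed.

Lemma cstar_genZ (k : R[i]) a : cstar_gen S a -> cstar_gen S (k *: a).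
Proof.
have [_ S1 Slin _ _] := cstar_genP S => Sa; rewrite -[_ *: _]addr0; apply: (Slin) => //.
by rewrite -(addNr 1) -scaleN1r; exact: Slin.
Qed.

Lemma cstar_gen_sum (I : finType) (F : I -> A) :
  (forall i, cstar_gen S (F i)) -> cstar_gen S (\sum_i F i).
Proof.
have [_ S1 Slin _ _] := cstar_genP S => SF; elim/big_rec: _ => [|i x _ Sx].
  by rewrite -(addNr 1) -scaleN1r; exact: Slin.
by rewrite -[F i]scale1r; exact: Slin.
Qed.

Lemma cstar_subP (a : cstar_sub S) : cstar_gen S (val a).
Proof. by have := valP a; rewrite inE. Qed.

Definition to_sub a (Sa : cstar_gen S a) : cstar_sub S := Sub a (mem_set Sa).

Lemma anorm_cstar_sub (x y : cstar_sub S) :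
  anorm (x - y : cstar_sub_cstar S) = anorm (val x - val y).
Proof. by rewrite -rmorphB. Qed.

(** The image in [A] of a C*-subalgebra of [cstar_sub S] is again a C*-subalgebra of [A]: limits of
    its elements stay in [cstar_gen S], which is closed. If it contains [S], it is therefore
    everything. *)
Lemma cstar_sub_gen :
  cstar_gen ([set a | S (val (a : cstar_sub S))] : set (cstar_sub_cstar S)) = setT.
Proof.
apply/seteqP; split=> // a _ E [Esub SE].
have [/closed_anorm Ecl E1 Elin EM Es] := Esub.
pose E' : set A := [set val (b : cstar_sub S) | b in E].
have : cstar_gen S (val (a : cstar_sub S)) by exact: cstar_subP.
move=> /(_ E'); case; last by move=> b Eb /val_inj <-.
split; last first.
  by move=> b Sb; exists (to_sub (cstar_gen_sub Sb)) => //; apply: SE.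
split.
- apply/closed_anorm => b hb.
  have Sb : cstar_gen S b.
    have [/closed_anorm Scl _ _ _ _] := cstar_genP S; apply: Scl => e /hb[_ [c _ <-] bc].
    by exists (val c) => //; exact: cstar_subP.
  by exists (to_sub Sb) => //; apply: Ecl => e /hb[_ [c Ec <-] bc]; exists c.
- by exists 1.
- move=> k _ _ [b Eb <-] [c Ec <-]; by exists (k *: b + c); first exact: Elin.
- move=> _ _ [b Eb <-] [c Ec <-]; by exists (b * c); first exact: EM.
- by move=> _ [b Eb <-]; exists (star b); first exact: Es.
Qed.

End Subalgebras.

(** * Tensor products of Hilbert spaces *)

Section TensorProduct.
Variables (R : realType) (H1 H2 K : hilbert R) (th : H1 -> H2 -> K).
Hypothesis thP : is_hilbert_tensor th.

Lemma dot_rnorm (H : hilbert R) (x : H) : complex.Re (dot x x) = rnorm x ^+ 2.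
Proof. by rewrite dot_norm rnormE -rmorphXn. Qed.

Lemma dotDr (H : hilbert R) (x y z : H) : dot x (y + z) = dot x y + dot x z.
Proof. by rewrite dotC dotDl rmorphD /= -!(dotC _ x). Qed.

Lemma dot0l (H : hilbert R) (x : H) : dot 0 x = 0.
Proof. by rewrite -[0 in LHS](scale0r 0) dotZl mul0r. Qed.

Lemma dot0r (H : hilbert R) (x : H) : dot x 0 = 0.
Proof. by rewrite dotC dot0l rmorph0. Qed.

Lemma dotBl (H : hilbert R) (x y z : H) : dot (x - y) z = dot x z - dot y z.
Proof. by rewrite dotDl -scaleN1r dotZl mulN1r. Qed.

Lemma rnorm_orth (H : hilbert R) (x y : H) : dot x y = 0 -> rnorm x <= rnorm (x - y).
Proof.
move=> xy; have rge0 (u : H) : 0 <= rnorm u by rewrite -lecR -rnormE normr_ge0.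
have yx : dot y x = 0 by rewrite dotC xy rmorph0.
have E u v : dot u (v - y) = dot u v - dot u y :> R[i].
  by rewrite dotC dotBl rmorphB /= -!(dotC _ u).
rewrite -(@ler_pXn2r _ 2) ?nnegrE // -!dot_rnorm dotBl !E xy yx subr0 sub0r opprK.
by rewrite [in leRHS](dot_norm y) rnormE -rmorphXn raddfD /= lerDl exprn_ge0.
Qed.

(* Pythagoras: w is no longer than its distance to any element of the span. *)
Lemma hilbert_tensor_orth (w : K) : (forall x y, dot w (th x y) = 0) -> w = 0.
Proof.
move=> wth; have [_ dense] := thP.
have wspan s : dot w (\sum_(p <- s) th p.1 p.2) = 0.
  elim: s => [|p s IH]; last by rewrite big_cons dotDr wth IH addr0.
  by rewrite big_nil dot0r.
apply/eqP; rewrite -normr_eq0 rnormE -(rmorph0 (real_complex R)).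
apply/eqP; congr (_%:C)%C; apply/le_anti; rewrite -[0 <= _]lecR -rnormE normr_ge0 andbT.
apply/ler_addgt0Pr => e e0; rewrite add0r.
have : closure [set x : K | exists s : seq (H1 * H2), x = \sum_(p <- s) th p.1 p.2] w.
  by rewrite dense.
move=> /closure_rnorm/(_ e e0)[_ [s ->]] ws; apply/ltW/(le_lt_trans _ ws).
exact: rnorm_orth.
Qed.

Lemma hilbert_tensor_eq (u v : K) :
  (forall x y, dot u (th x y) = dot v (th x y)) -> u = v.
Proof.
move=> uv; apply/eqP; rewrite -subr_eq0; apply/eqP/hilbert_tensor_orth => x y.
by rewrite dotBl uv subrr.
Qed.

Lemma hilbert_tensor_linl (k : R[i]) x x' y : th (k *: x + x') y = k *: th x y + th x' y.
Proof.
have [dotth _] := thP; apply: hilbert_tensor_eq => u v.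
by rewrite dotDl dotZl !dotth dotDl dotZl mulrDl mulrA.
Qed.

Lemma hilbert_tensor_linr (k : R[i]) x y y' : th x (k *: y + y') = k *: th x y + th x y'.
Proof.
have [dotth _] := thP; apply: hilbert_tensor_eq => u v.
by rewrite dotDl dotZl !dotth dotDl dotZl mulrDr mulrCA.
Qed.

End TensorProduct.

(** * Algebraic laws of elementary tensors *)

Section CstarTensor.
Variables (R : realType) (A1 A2 B : cstarAlg R) (t : A1 -> A2 -> B).
Hypothesis tP : is_cstar_tensor t.

(** Each law holds for the operators on elementary tensors of vectors, and elements of [B] are
    determined by these values because [rho] is faithful. *)
Lemma cstar_tensor_algebra :
  [/\ t 1 1 = 1,
      forall a a' b b', t a b * t a' b' = t (a * a') (b * b'),
      forall a b, star (t a b) = t (star a) (star b),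
      forall (k : R[i]) a a' b, t (k *: a + a') b = k *: t a b + t a' b &
      forall (k : R[i]) a b b', t a (k *: b + b') = k *: t a b + t a b'].
Proof.
have [_ [H1 [H2 [K [th [pi1 [pi2 [rho [thP [r1 _] [r2 _] [r3 rf] rt]]]]]]]]] := tP.
have rhoB b b' x : rho (b - b') x = rho b x - rho b' x.
  by rewrite -scaleN1r addrC (star_rep_lin r3) scaleN1r addrC.
have kill b : (forall x y, rho b (th x y) = 0) -> b = 0.
  move=> hb; rewrite -[b]starK; suff -> : star b = 0 by exact: star0.
  apply: rf => z; apply: (hilbert_tensor_orth thP) => x y.
  by rewrite (star_rep_star r3) hb dot0r.
have eqB b b' : (forall x y, rho b (th x y) = rho b' (th x y)) -> b = b'.
  by move=> h; apply/eqP; rewrite -subr_eq0; apply/eqP/kill => x y; rewrite rhoB h subrr.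
split.
- by apply: eqB => x y; rewrite rt (star_rep_one r1) (star_rep_one r2) (star_rep_one r3).
- move=> a a' b b'; apply: eqB => x y.
  by rewrite (star_rep_mul r3) !rt (star_rep_mul r1) (star_rep_mul r2).
- move=> a b; apply: eqB => x y; apply: (hilbert_tensor_eq thP) => u v.
  have [dotth _] := thP.
  by rewrite (star_rep_star r3) !rt !dotth (star_rep_star r1) (star_rep_star r2).
- move=> k a a' b; apply: eqB => x y.
  by rewrite (star_rep_lin r3) !rt (star_rep_lin r1) (hilbert_tensor_linl thP).
- move=> k a b b'; apply: eqB => x y.
  by rewrite (star_rep_lin r3) !rt (star_rep_lin r2) (hilbert_tensor_linr thP).
Qed.

End CstarTensor.

(** * Restriction of the comultiplication to a subalgebra *)

Section RestrictedComult.
Variables (R : realType) (A : cstarAlg R) (D : comult A) (S : set A).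

(** These elementary tensors generate, inside the codomain of [D], the C*-algebra that serves as
    codomain of the restricted comultiplication. *)
Let T : set (comult_cod D) :=
  [set b | exists a a' : cstar_sub S, b = comult_tens D (val a) (val a')].

Hypothesis DS : forall a, S a -> cstar_gen T (D a).

Let tens_in (a a' : cstar_sub S) : cstar_gen T (comult_tens D (val a) (val a')).
Proof. by apply: cstar_gen_sub; exists a, a'. Qed.

Let sub_tens (a a' : cstar_sub_cstar S) : cstar_sub_cstar T := to_sub (tens_in a a').

(** Finite sums of elementary tensors form a unital star-subalgebra, so their closure is a
    C*-subalgebra, and it contains the generators. *)
Let tens_dense (b : comult_cod D) : cstar_gen T b ->
  closure ([set b | exists s : seq (cstar_sub S * cstar_sub S),
    b = \sum_(p <- s) comult_tens D (val p.1) (val p.2)] : set (nalg_space _)) b.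
Proof.
have [t1 tM ts tl _] := cstar_tensor_algebra (comult_tensP D).
set L := (X in closure X) => hb; apply: hb; split; last first.
  move=> _ [a [a' ->]]; apply: subset_closure; exists [:: (a, a')].
  by rewrite big_seq1.
have tZ (k : R[i]) a a' : comult_tens D (k *: a) a' = k *: comult_tens D a a'.
  have t0 : comult_tens D 0 a' = 0.
    by apply: (addrI (1 *: comult_tens D 0 a')); rewrite -tl scaler0 addr0 scale1r addr0.
  by rewrite -[k *: a]addr0 tl t0 addr0.
apply: closure_cstar_subalg.
- by exists [:: (1, 1)]; rewrite big_seq1; exact: esym t1.
- move=> k _ _ [s ->] [s' ->].
  exists ([seq (k *: p.1, p.2) | p <- s] ++ s').
  rewrite big_cat big_map scaler_sumr; congr (_ + _); apply: eq_bigr => p _.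
  by rewrite -tZ.
- move=> _ _ [s ->] [s' ->].
  exists [seq (p.1 * q.1, p.2 * q.2) | p <- s, q <- s'].
  rewrite big_allpairs_dep big_distrl; apply: eq_bigr => p _.
  by rewrite big_distrr; apply: eq_bigr => q _ /=; rewrite tM.
- move=> _ [s ->]; exists [seq (cstar_sub_star p.1, cstar_sub_star p.2) | p <- s].
  rewrite big_map (big_morph _ (@starD _ _) (@star0 _ _)); apply: eq_bigr => p _.
  by rewrite ts.
Qed.

(** The Hilbert spaces are kept and the three representations restricted; a faithful representation
    stays faithful on a subalgebra. *)
Lemma sub_tensP : is_cstar_tensor sub_tens.
Proof.
split.
  apply/seteqP; split=> // b _; apply/closure_anorm => e e0.
  have /closure_anorm/(_ e e0)[_ [s ->] hs] := tens_dense (cstar_subP (b : cstar_sub T)).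
  exists (\sum_(p <- s) sub_tens p.1 p.2); first by exists s.
  have vs : val (\sum_(p <- s) sub_tens p.1 p.2 : cstar_sub T) =
      \sum_(p <- s) comult_tens D (val p.1) (val p.2).
    by rewrite raddf_sum.
  by rewrite anorm_cstar_sub vs.
have [_ [H1 [H2 [K [th [pi1 [pi2 [rho [thP [r1 f1] [r2 f2] [r3 f3] rt]]]]]]]]] := comult_tensP D.
have rep (A' : cstarAlg R) (S' : set A') (H : hilbert R) (pi : A' -> H -> H) :
    is_star_rep pi -> is_faithful pi ->
    is_star_rep (fun a : cstar_sub_cstar S' => pi (val (a : cstar_sub S'))) /\
    is_faithful (fun a : cstar_sub_cstar S' => pi (val (a : cstar_sub S'))).
  move=> [h1 h2 h3 h4 h5] f; split; last by move=> a /f a0; apply: val_inj.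
  split.
  - by move=> a; exact: h1.
  - by move=> k a b x; exact: h2.
  - by move=> a b x; exact: h3.
  - exact: h4.
  - by move=> a x y; exact: h5.
exists H1, H2, K, th, (fun a => pi1 (val (a : cstar_sub S))),
  (fun a => pi2 (val (a : cstar_sub S))), (fun b => rho (val (b : cstar_sub T))).
split=> //.
- exact: (rep A S H1 pi1 r1 f1).
- exact: (rep A S H2 pi2 r2 f2).
- exact: (rep _ T K rho r3 f3).
- by move=> a b x y; exact: rt.
Qed.

(** The elements that [D] sends into the generated subalgebra form a C*-subalgebra containing [S];
    only closedness requires continuity. *)
Let comult_in (a : cstar_sub S) : cstar_gen T (D (val a)).
Proof.
have [/closed_anorm Tcl T1 Tlin TM Ts] := cstar_genP T.
suff : [set a | cstar_gen T (D a)] (val a) by [].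
apply: (cstar_subP a); split; last exact: DS.
split.
- apply/closed_anorm => b hb; apply: Tcl => e e0.
  (* Half the tolerance absorbs the factor 2 of [star_morphism_norm]. *)
  have [c Tc bc] := hb (e / 2) (divr_gt0 e0 (ltr0Sn _ 1)).
  exists (D c) => //; rewrite -raddfB.
  apply: le_lt_trans (star_morphism_norm (@comult_star _ _ D) _) _.
  by rewrite mulrC -ltr_pdivlMr.
- by rewrite /= rmorph1.
- by move=> k b c /= hb hc; rewrite linearP; exact: Tlin.
- by move=> b c /= hb hc; rewrite rmorphM; exact: TM.
- by move=> b /= hb; rewrite (comult_star D); exact: Ts.
Qed.

Definition sub_comult_map (a : cstar_sub S) : cstar_sub T := to_sub (comult_in a).

Lemma sub_comult_linear : linear sub_comult_map.
Proof. by move=> k a b; apply: val_inj; rewrite /= linearP. Qed.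

Lemma sub_comult_monoid : GRing.monoid_morphism sub_comult_map.
Proof. by split=> [|a b]; apply: val_inj; rewrite /= ?rmorph1 ?rmorphM. Qed.

HB.instance Definition _ :=
  GRing.isLinear.Build R[i] (cstar_sub S) (cstar_sub T) *:%R sub_comult_map sub_comult_linear.
HB.instance Definition _ :=
  GRing.isMonoidMorphism.Build (cstar_sub S) (cstar_sub T) sub_comult_map sub_comult_monoid.

Lemma sub_comult_star :
  @is_star_morphism R (cstar_sub_cstar S) (cstar_sub_cstar T)
    (sub_comult_map : {lrmorphism cstar_sub S -> cstar_sub T}).
Proof. by move=> a; apply: val_inj; rewrite /= (comult_star D). Qed.

Definition sub_comult : comult (cstar_sub_cstar S) := Comult sub_tensP sub_comult_star.

Lemma sub_comult_corep (I : finType) (v : fmx (cstar_sub_cstar S) I I) :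
  is_corep D (fun i j => val (v i j : cstar_sub S)) -> is_corep sub_comult v.
Proof.
move=> h i j; apply: val_inj.
have -> : val (\sum_k comult_tens sub_comult (v i k) (v k j) : cstar_sub T) =
    \sum_k val (comult_tens sub_comult (v i k) (v k j) : cstar_sub T).
  exact: (raddf_sum (val : cstar_sub T -> comult_cod D)).
exact: h.
Qed.

End RestrictedComult.

(** * Matrices *)

Section FmxRing.
Variable A : pzRingType.

Lemma fmxP (I J : Type) (M N : fmx A I J) : (forall i j, M i j = N i j) -> M = N.
Proof. by move=> e; apply/funext => i; apply/funext => j. Qed.

Lemma fmx_mulA (I J K L : finType) (M : fmx A I J) (N : fmx A J K) (P : fmx A K L) :
  fmx_mul M (fmx_mul N P) = fmx_mul (fmx_mul M N) P.
Proof.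
apply: fmxP => i l; rewrite /fmx_mul.
under eq_bigr => j _ do rewrite big_distrr /=.
rewrite exchange_big; apply: eq_bigr => k _; rewrite big_distrl.
by apply: eq_bigr => j _; rewrite mulrA.
Qed.

Lemma fmx_mul1l (I J : finType) (M : fmx A I J) : fmx_mul (@fmx_one A I) M = M.
Proof.
apply: fmxP => i j; rewrite /fmx_mul /fmx_one (bigD1 i) //= eqxx mul1r big1 ?addr0 //.
by move=> k /negbTE; rewrite eq_sym => ->; rewrite mul0r.
Qed.

Lemma fmx_mul1r (I J : finType) (M : fmx A I J) : fmx_mul M (@fmx_one A J) = M.
Proof.
apply: fmxP => i j; rewrite /fmx_mul /fmx_one (bigD1 j) //= eqxx mulr1 big1 ?addr0 //.
by move=> k /negbTE ->; rewrite mulr0.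
Qed.

Lemma fmx_mul_reindex (I J K K' : finType) (f : K' -> K) (M : fmx A I K) (N : fmx A K J) :
  bijective f -> fmx_mul M N = fmx_mul (fun i k => M i (f k)) (fun k j => N (f k) j).
Proof.
by move=> fbij; apply: fmxP => i j; rewrite /fmx_mul (reindex f) //; exact: onW_bij.
Qed.

End FmxRing.

Lemma mul_cnat (A : pzRingType) (b c : bool) : (b%:R * c%:R = (b && c)%:R :> A)%R.
Proof. by rewrite -natrM mulnb. Qed.

Section ScalarMatrices.
Variable R : realType.
Implicit Types (I J K : finType).
Local Notation C := R[i].

Lemma cmx_adjK I J (M : fmx C I J) : cmx_adj (cmx_adj M) = M.
Proof. by apply: fmxP => i j; exact: conjCK. Qed.

Lemma cmx_adj_mul I J K (M : fmx C I J) (N : fmx C J K) :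
  cmx_adj (fmx_mul M N) = fmx_mul (cmx_adj N) (cmx_adj M).
Proof.
apply: fmxP => i j; rewrite /cmx_adj /fmx_mul rmorph_sum; apply: eq_bigr => k _.
by rewrite rmorphM mulrC.
Qed.

Lemma cmx_conj_mul I J K (M : fmx C I J) (N : fmx C J K) :
  cmx_conj (fmx_mul M N) = fmx_mul (cmx_conj M) (cmx_conj N).
Proof.
apply: fmxP => i j; rewrite /cmx_conj /fmx_mul rmorph_sum; apply: eq_bigr => k _.
by rewrite rmorphM.
Qed.

Lemma cmx_unitaryE I J (M : fmx C I J) : cmx_unitary M <->
  fmx_mul M (cmx_adj M) = @fmx_one _ I /\ fmx_mul (cmx_adj M) M = @fmx_one _ J.
Proof. by split=> -[h1 h2]; split=> [|]; [exact: fmxP|exact: fmxP|rewrite h1|rewrite h2]. Qed.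

Lemma cmx_unitary_mul I J K (M : fmx C I J) (N : fmx C J K) :
  cmx_unitary M -> cmx_unitary N -> cmx_unitary (fmx_mul M N).
Proof.
move=> /cmx_unitaryE[M1 M2] /cmx_unitaryE[N1 N2]; apply/cmx_unitaryE.
rewrite cmx_adj_mul; split.
  by rewrite -fmx_mulA [fmx_mul N _]fmx_mulA N1 fmx_mul1l.
by rewrite -fmx_mulA [fmx_mul (cmx_adj M) _]fmx_mulA M2 fmx_mul1l.
Qed.

Lemma cmx_unitary_adj I J (M : fmx C I J) : cmx_unitary M -> cmx_unitary (cmx_adj M).
Proof. by move=> [M1 M2]; split; rewrite cmx_adjK. Qed.

Lemma fmx_one_conj I (i j : I) : (@fmx_one C I i j)^* = fmx_one _ i j.
Proof. by rewrite /fmx_one; case: eqP => _; rewrite ?conjC1 ?conjC0. Qed.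

Lemma cmx_unitary_conj I J (M : fmx C I J) : cmx_unitary M -> cmx_unitary (cmx_conj M).
Proof.
by move=> [M1 M2]; split=> i j; [rewrite -fmx_one_conj -M1|rewrite -fmx_one_conj -M2];
  rewrite /fmx_mul rmorph_sum; apply: eq_bigr => k _; rewrite rmorphM.
Qed.

Lemma cmx_unitary_reindex I J K (f : K -> J) (M : fmx C I J) : bijective f ->
  cmx_unitary M -> cmx_unitary (fun i k => M i (f k)).
Proof.
move=> fbij [M1 M2]; split=> i j.
  by rewrite -M1 (fmx_mul_reindex _ _ fbij).
by rewrite [LHS]M2 /fmx_one (bij_eq fbij).
Qed.

Definition cmx_tensor I J K L (M : fmx C I J) (N : fmx C K L) : fmx C (I * K)%type (J * L)%type :=
  fun i j => M i.1 j.1 * N i.2 j.2.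

Lemma cmx_unitary_tensor I J K (L : finType) (M : fmx C I J) (N : fmx C K L) :
  cmx_unitary M -> cmx_unitary N -> cmx_unitary (cmx_tensor M N).
Proof.
have mulT (I' J' K' L' I'' K'' : finType) (M' : fmx C I' J') (N' : fmx C K' L')
    (M'' : fmx C J' I'') (N'' : fmx C L' K'') i j :
    fmx_mul (cmx_tensor M' N') (cmx_tensor M'' N'') i j =
    fmx_mul M' M'' i.1 j.1 * fmx_mul N' N'' i.2 j.2.
  rewrite /fmx_mul big_distrlr pair_big; apply: eq_bigr => k _ /=.
  by rewrite /cmx_tensor mulrACA.
have oneT (I' K' : finType) (i j : I' * K') :
    fmx_one C i j = fmx_one C i.1 j.1 * fmx_one C i.2 j.2.
  by rewrite /fmx_one mul_cnat; case: i j => [i1 i2] [j1 j2].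
have adjT : cmx_adj (cmx_tensor M N) = cmx_tensor (cmx_adj M) (cmx_adj N).
  by apply: fmxP => i j; rewrite /cmx_adj /cmx_tensor rmorphM.
move=> [M1 M2] [N1 N2]; split=> i j; rewrite adjT mulT oneT; first by rewrite M1 N1.
by rewrite M2 N2.
Qed.

(** Stated for scalar matrices: interleaving the factors of the two words uses commutativity. *)
Lemma fmx_word_mul I J K (Mo Mb : fmx C I J) (No Nb : fmx C J K) x :
  fmx_word (fmx_mul Mo No) (fmx_mul Mb Nb) x =
  fmx_mul (fmx_word Mo Mb x) (fmx_word No Nb x).
Proof.
apply: fmxP => i j; rewrite /fmx_word /fmx_mul.
under [RHS]eq_bigr => k _ do rewrite -big_split.
rewrite -(bigA_distr_bigA (fun l k =>
  (match letter l with White => Mo | Black => Mb end) (i l) k *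
  (match letter l with White => No | Black => Nb end) k (j l))) /=.
by apply: eq_bigr => l _; case: (letter l).
Qed.

Lemma fmx_word_one I x : fmx_word (@fmx_one C I) (@fmx_one C I) x = @fmx_one C _.
Proof.
apply: fmxP => i j; rewrite /fmx_word /fmx_one.
have [->|ij] := eqVneq i j; first by rewrite big1 // => l _; case: letter; rewrite eqxx.
have [l nl] : exists l, i l != j l.
  by apply/existsP; apply: contraNT ij => /existsPn h; apply/eqP/ffunP => l;
    have := h l; rewrite negbK => /eqP.
by rewrite (bigD1 l) //=; case: letter; rewrite (negbTE nl) mul0r.
Qed.

Lemma cmx_adj_word I J (Mo Mb : fmx C I J) x :
  cmx_adj (fmx_word Mo Mb x) = fmx_word (cmx_adj Mo) (cmx_adj Mb) x.
Proof.
apply: fmxP => i j; rewrite /cmx_adj /fmx_word rmorph_prod; apply: eq_bigr => l _.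
by case: letter.
Qed.

Lemma cmx_unitary_word I J (Mo Mb : fmx C I J) x :
  cmx_unitary Mo -> cmx_unitary Mb -> cmx_unitary (fmx_word Mo Mb x).
Proof.
move=> /cmx_unitaryE[w1 w2] /cmx_unitaryE[b1 b2]; apply/cmx_unitaryE.
by rewrite cmx_adj_word -!fmx_word_mul w1 w2 b1 b2 !fmx_word_one.
Qed.

(* Two relations inverse to each other are graphs of bijections. *)
Lemma inverse_relations_unitary (X : finType) (P S : rel X) :
  (forall a b, (exists2 h, P a h & S h b) <-> a = b) ->
  (forall a b, (exists2 h, S a h & P h b) <-> a = b) ->
  cmx_unitary (fun a b => (P a b)%:R : C).
Proof.
move=> PS SP.
have PtoS a b : P a b -> S b a.
  move=> ab; have [k Sbk _] := (SP b b).2 erefl.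
  by have -> : a = k by apply/PS; exists b.
have rowP a a' : \sum_b (P a b)%:R * ((P a' b)%:R)^* = fmx_one C a a'.
  have [b ab _] := (PS a a).2 erefl.
  rewrite (bigD1 b) //= big1 ?addr0 => [|c cb]; last first.
    case: (boolP (P a c)) => [ac|_]; last by rewrite mul0r.
    by case/eqP: cb; apply/SP; exists a => //; exact: PtoS.
  rewrite ab mul1r /fmx_one; have [<-|aa'] := eqVneq a a'; first by rewrite ab conjC1.
  case: (boolP (P a' b)) => [a'b|_]; last by rewrite conjC0.
  by case/eqP: aa'; apply/PS; exists b => //; exact: PtoS.
have colP b b' : \sum_a ((P a b)%:R)^* * (P a b')%:R = fmx_one C b b'.
  have [a _ ab] := (SP b b).2 erefl.
  rewrite (bigD1 a) //= big1 ?addr0 => [|c ca]; last first.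
    case: (boolP (P c b)) => [cb|_]; last by rewrite conjC0 mul0r.
    by case/eqP: ca; apply/PS; exists b => //; exact: PtoS.
  rewrite ab conjC1 mul1r /fmx_one; have [<-|bb'] := eqVneq b b'; first by rewrite ab.
  case: (boolP (P a b')) => [ab'|//].
  by case/eqP: bb'; apply/SP; exists a => //; exact: PtoS.
by split=> i j; [exact: rowP|exact: colP].
Qed.

End ScalarMatrices.

(** * Intertwiners and unitaries over a C*-algebra *)

Section AlgebraMatrices.
Variables (R : realType) (A : cstarAlg R).
Implicit Types (I J K : finType).
Local Notation C := R[i].

Definition emb I J (T : fmx C I J) : fmx A I J := fun i j => (T i j)%:A.

Lemma emb_mul I J K (S : fmx C I J) (T : fmx C J K) :
  emb (fmx_mul S T) = fmx_mul (emb S) (emb T).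
Proof.
apply: fmxP => i j; rewrite /emb /fmx_mul scaler_suml; apply: eq_bigr => k _.
by rewrite mulr_algl scalerA.
Qed.

Lemma emb_one I : emb (@fmx_one C I) = @fmx_one A I.
Proof. by apply: fmxP => i j; rewrite /emb /fmx_one scaler_nat. Qed.

Lemma intertwinerE I J (v : fmx A I I) (w : fmx A J J) (T : fmx C J I) :
  intertwiner v w T <-> fmx_mul (emb T) v = fmx_mul w (emb T).
Proof.
have e1 j i : fmx_mul (emb T) v j i = \sum_k T j k *: v k i.
  by apply: eq_bigr => k _; rewrite mulr_algl.
have e2 j i : fmx_mul w (emb T) j i = \sum_k T k i *: w j k.
  by apply: eq_bigr => k _; rewrite mulr_algr.
split=> [h|h j i]; first by apply: fmxP => j i; rewrite e1 e2.
by rewrite -e1 -e2 h.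
Qed.

Lemma intertwiner_comp I J K (v : fmx A I I) (w : fmx A J J) (z : fmx A K K) S T :
  intertwiner v w T -> intertwiner w z S -> intertwiner v z (fmx_mul S T).
Proof.
move=> /intertwinerE hT /intertwinerE hS; apply/intertwinerE.
by rewrite emb_mul -fmx_mulA hT fmx_mulA hS fmx_mulA.
Qed.

Lemma intertwiner_adj I J (v : fmx A I I) (w : fmx A J J) T :
  cmx_unitary T -> intertwiner v w T -> intertwiner w v (cmx_adj T).
Proof.
move=> /cmx_unitaryE[T1 T2] /intertwinerE hT; apply/intertwinerE.
rewrite -[LHS]fmx_mul1r -emb_one -T1 emb_mul fmx_mulA -[X in fmx_mul X _]fmx_mulA.
by rewrite -hT fmx_mulA -emb_mul T2 emb_one fmx_mul1l.
Qed.

(** Scalars leave the ordered products, so both sums over functions factor into one-letter sums,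
    which agree letter by letter. *)
Lemma intertwiner_word I J (vo vb : fmx A I I) (wo wb : fmx A J J) To Tb x :
  intertwiner vo wo To -> intertwiner vb wb Tb ->
  intertwiner (fmx_word vo vb x) (fmx_word wo wb x) (fmx_word To Tb x).
Proof.
move=> ho hb j i; rewrite /fmx_word.
under eq_bigr => k _ do rewrite -scaler_prod.
under [RHS]eq_bigr => k _ do rewrite -scaler_prod.
rewrite -(bigA_distr_bigA (fun l k =>
  (match letter l with White => To | Black => Tb end) (j l) k *:
  (match letter l with White => vo | Black => vb end) k (i l))) /=.
rewrite -(bigA_distr_bigA (fun l k =>
  (match letter l with White => To | Black => Tb end) k (i l) *:
  (match letter l with White => wo | Black => wb end) (j l) k)) /=.
by apply: eq_bigr => l _; case: (letter l).
Qed.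

Lemma amx_unitaryE I (u : fmx A I I) : amx_unitary u <->
  fmx_mul u (amx_adj u) = @fmx_one _ I /\ fmx_mul (amx_adj u) u = @fmx_one _ I.
Proof. by split=> -[h1 h2]; split=> [|]; [exact: fmxP|exact: fmxP|rewrite h1|rewrite h2]. Qed.

Lemma amx_unitary_reindex I J (f : J -> I) (u : fmx A I I) : bijective f ->
  amx_unitary u -> amx_unitary (fun i j => u (f i) (f j)).
Proof.
move=> fbij [u1 u2].
have e i j : fmx_one A i j = fmx_one A (f i) (f j) by rewrite /fmx_one (bij_eq fbij).
by split=> i j; rewrite e; [rewrite -u1|rewrite -u2]; rewrite (fmx_mul_reindex _ _ fbij).
Qed.

Lemma amx_unitary_tensor I J (u : fmx A I I) (v : fmx A J J) :
  amx_unitary u -> amx_unitary v -> amx_unitary (amx_tensor u v).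
Proof.
have oneT (i j : I * J) : fmx_one A i j = fmx_one A i.1 j.1 * fmx_one A i.2 j.2.
  by rewrite /fmx_one mul_cnat; case: i j => [i1 i2] [j1 j2].
move=> [u1 u2] [v1 v2]; split=> i j; rewrite oneT /fmx_mul /amx_adj /amx_tensor.
  rewrite -(pair_bigA _ (fun k l => u i.1 k * v i.2 l * star (u j.1 k * v j.2 l))) /=.
  rewrite -u1 /fmx_mul big_distrl; apply: eq_bigr => k _ /=.

  under eq_bigr => l _ do rewrite starM -mulrA [v _ _ * _]mulrA.
  rewrite -big_distrr -big_distrl /=.
  have -> : \sum_l v i.2 l * star (v j.2 l) = fmx_one A i.2 j.2 by exact: v1.
  by rewrite /fmx_one; case: eqP => _; rewrite /= ?mul1r ?mulr1 ?mul0r ?mulr0 ?mul0r.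
(* In the adjoint times the matrix, the entries of [u] are the inner factors, so the sum over their
   index must be evaluated first. *)
rewrite (reindex (fun p : J * I => (p.2, p.1))) /=; last first.
  by exists (fun p : I * J => (p.2, p.1)) => -[].
rewrite -(pair_bigA _ (fun l k => star (u k i.1 * v l i.2) * (u k j.1 * v l j.2))) /=.
under eq_bigr => l _.
  under eq_bigr => k _ do rewrite starM -mulrA [star (u _ _) * _]mulrA.
  rewrite -big_distrr -big_distrl /=.
  have -> : \sum_k star (u k i.1) * u k j.1 = fmx_one A i.1 j.1 by exact: u2.
  over.
have -> : fmx_one A i.2 j.2 = \sum_l star (v l i.2) * v l j.2 by rewrite -v2.
rewrite big_distrr; apply: eq_bigr => l _ /=.
by rewrite /fmx_one; case: eqP => _; rewrite /= ?mul1r ?mulr1 ?mul0r ?mulr0 ?mul0r.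
Qed.

Definition amx_conjugate I (W : fmx C I I) (v : fmx A I I) : fmx A I I :=
  fmx_mul (emb W) (fmx_mul v (emb (cmx_adj W))).

Lemma amx_conjugate_unitary I (W : fmx C I I) (v : fmx A I I) :
  cmx_unitary W -> amx_unitary v -> amx_unitary (amx_conjugate W v).
Proof.
have adjM (M N : fmx A I I) : amx_adj (fmx_mul M N) = fmx_mul (amx_adj N) (amx_adj M).
  apply: fmxP => i j; rewrite /amx_adj /fmx_mul star_sum; apply: eq_bigr => k _.
  by rewrite starM.
have adjE (T : fmx C I I) : amx_adj (emb T) = emb (cmx_adj T).
  by apply: fmxP => i j; rewrite /amx_adj /emb starZ star1.
move=> /cmx_unitaryE[W1 W2] /amx_unitaryE[v1 v2]; apply/amx_unitaryE.
rewrite /amx_conjugate !adjM !adjE cmx_adjK; split.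
  rewrite !fmx_mulA -[fmx_mul (fmx_mul _ (emb (cmx_adj W))) (emb W)]fmx_mulA.
  rewrite -emb_mul W2 emb_one fmx_mul1r.
  rewrite -[fmx_mul (fmx_mul _ v) _]fmx_mulA v1 fmx_mul1r.
  by rewrite -emb_mul W1 emb_one.
rewrite !fmx_mulA -[fmx_mul (fmx_mul _ (emb (cmx_adj W))) (emb W)]fmx_mulA.
rewrite -emb_mul W2 emb_one fmx_mul1r.
rewrite -[fmx_mul (fmx_mul _ (amx_adj v)) _]fmx_mulA v2 fmx_mul1r.
by rewrite -emb_mul W1 emb_one.
Qed.

Lemma amx_conjugate_intertwiner I (W : fmx C I I) (v : fmx A I I) :
  cmx_unitary W -> intertwiner v (amx_conjugate W v) W.
Proof.
move=> /cmx_unitaryE[_ W2]; apply/intertwinerE.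
by rewrite /amx_conjugate -!fmx_mulA -emb_mul W2 emb_one fmx_mul1r.
Qed.

Lemma intertwiner_conjugate I (W : fmx C I I) (v w : fmx A I I) :
  cmx_unitary W -> intertwiner v w W -> w = amx_conjugate W v.
Proof.
move=> /cmx_unitaryE[W1 _] /intertwinerE h.
by rewrite /amx_conjugate fmx_mulA h -fmx_mulA -emb_mul W1 emb_one fmx_mul1r.
Qed.

Lemma amx_conjugateE I (W : fmx C I I) (v : fmx A I I) i j :
  amx_conjugate W v i j = \sum_k \sum_l (W i k * (W j l)^*) *: v k l.
Proof.
rewrite /amx_conjugate /fmx_mul; apply: eq_bigr => k _; rewrite mulr_algl scaler_sumr.
by apply: eq_bigr => l _; rewrite mulr_algr scalerA.
Qed.

(** The entries of a conjugate by scalar matrices are linear combinations of the original ones; this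
    keeps the black representation of PG inside its algebra. *)
Lemma amx_conjugate_gen (S : set A) I (W : fmx C I I) (v : fmx A I I) :
  (forall i j, cstar_gen S (v i j)) -> forall i j, cstar_gen S (amx_conjugate W v i j).
Proof.
move=> hv i j; rewrite amx_conjugateE.
by do 2! (apply: cstar_gen_sum => ?); exact: cstar_genZ.
Qed.

End AlgebraMatrices.

(** * Corepresentations under tensor product and conjugation *)

Section Corep.
Variables (R : realType) (A : cstarAlg R) (D : comult A).
Implicit Types (I J : finType).
Local Notation C := R[i].
Local Notation t := (comult_tens D).

Lemma is_corep_reindex I J (f : J -> I) (v : fmx A I I) : bijective f ->
  is_corep D v -> is_corep D (fun i j => v (f i) (f j)).
Proof.
by move=> fbij h i j; rewrite h (reindex f) //; exact: onW_bij.
Qed.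

Lemma is_corep_tensor I J (u : fmx A I I) (v : fmx A J J) :
  is_corep D u -> is_corep D v -> is_corep D (amx_tensor u v).
Proof.
have [_ tM _ _ _] := cstar_tensor_algebra (comult_tensP D).
move=> hu hv i j; rewrite /amx_tensor rmorphM /= hu hv big_distrlr pair_big.
by apply: eq_bigr => k _; rewrite /= tM.
Qed.

Lemma is_corep_star I (v : fmx A I I) : is_corep D v -> is_corep D (amx_conj v).
Proof.
have [_ _ ts _ _] := cstar_tensor_algebra (comult_tensP D).
move=> hv i j; rewrite /amx_conj (comult_star D) hv star_sum.
by apply: eq_bigr => k _; rewrite ts.
Qed.

(** The matrix product with elementary tensors for products of entries: [v] is a corepresentation
    when [D] applied entrywise gives [tens_mul v v]. *)
Definition tens_mul I J K (M : fmx A I J) (N : fmx A J K) : fmx (comult_cod D) I K :=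
  fun i j => \sum_k t (M i k) (N k j).

Lemma tens_suml (K : finType) (c : K -> C) (F : K -> A) b :
  t (\sum_k c k *: F k) b = \sum_k c k *: t (F k) b.
Proof.
have [_ _ _ tl _] := cstar_tensor_algebra (comult_tensP D).
have t0 : t 0 b = 0.
  by apply: (addrI (1 *: t 0 b)); rewrite -tl scaler0 addr0 scale1r addr0.
by elim/big_rec2: _ => // k x y _ <-; rewrite tl.
Qed.

Lemma tens_sumr (K : finType) (c : K -> C) (F : K -> A) b :
  t b (\sum_k c k *: F k) = \sum_k c k *: t b (F k).
Proof.
have [_ _ _ _ tr] := cstar_tensor_algebra (comult_tensP D).
have t0 : t b 0 = 0.
  by apply: (addrI (1 *: t b 0)); rewrite -tr scaler0 addr0 scale1r addr0.
by elim/big_rec2: _ => // k x y _ <-; rewrite tr.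
Qed.

Lemma emb_mulE (B : cstarAlg R) (I J K : finType) (W : fmx C I J) (M : fmx B J K) i k :
  fmx_mul (emb B W) M i k = \sum_j W i j *: M j k.
Proof. by apply: eq_bigr => j _; rewrite mulr_algl. Qed.

Lemma mul_embE (B : cstarAlg R) (I J K : finType) (M : fmx B I J) (W : fmx C J K) i k :
  fmx_mul M (emb B W) i k = \sum_j W j k *: M i j.
Proof. by apply: eq_bigr => j _; rewrite mulr_algr. Qed.

Lemma tens_mul_embl (I J K L : finType) (W : fmx C I J) (M : fmx A J K) (N : fmx A K L) :
  tens_mul (fmx_mul (emb A W) M) N = fmx_mul (emb _ W) (tens_mul M N).
Proof.
apply: fmxP => i l; rewrite emb_mulE /tens_mul.
under eq_bigr => k _ do rewrite emb_mulE tens_suml.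
by rewrite exchange_big; apply: eq_bigr => j _; rewrite scaler_sumr.
Qed.

Lemma tens_mul_embr (I J K L : finType) (M : fmx A I J) (N : fmx A J K) (W : fmx C K L) :
  tens_mul M (fmx_mul N (emb A W)) = fmx_mul (tens_mul M N) (emb _ W).
Proof.
apply: fmxP => i l; rewrite mul_embE /tens_mul.
under eq_bigr => k _ do rewrite mul_embE tens_sumr.
by rewrite exchange_big; apply: eq_bigr => j _; rewrite scaler_sumr.
Qed.

Lemma tens_mul_embm (I J K L : finType) (M : fmx A I J) (W : fmx C J K) (N : fmx A K L) :
  tens_mul (fmx_mul M (emb A W)) N = tens_mul M (fmx_mul (emb A W) N).
Proof.
apply: fmxP => i l; rewrite /tens_mul.
under eq_bigr => k _ do rewrite mul_embE tens_suml.
under [RHS]eq_bigr => k _ do rewrite emb_mulE tens_sumr.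
exact: exchange_big.
Qed.

(** Scalar matrices move across the tensor sign, so the inner adjoint of [W] meets [W] and
    cancels. *)
Lemma is_corep_conjugate I (W : fmx C I I) (v : fmx A I I) :
  cmx_unitary W -> is_corep D v -> is_corep D (amx_conjugate W v).
Proof.
move=> /cmx_unitaryE[_ W2] hv.
suff E : tens_mul (amx_conjugate W v) (amx_conjugate W v) = amx_conjugate W (tens_mul v v).
  move=> i j; have := congr1 (fun M => M i j) E; rewrite /tens_mul => /= ->.
  rewrite !amx_conjugateE linear_sum; apply: eq_bigr => k _.
  by rewrite linear_sum; apply: eq_bigr => l _; rewrite linearZ /= hv.
rewrite /amx_conjugate tens_mul_embl tens_mul_embm.
rewrite [fmx_mul (emb A (cmx_adj W)) _]fmx_mulA -emb_mul W2 emb_one fmx_mul1l.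
by rewrite tens_mul_embr.
Qed.

End Corep.

(** * Flattened words *)

Lemma flat_pos_bij z x :
  bijective (fun kc : 'I_(size x) * 'I_(size z) => @flat_pos z x kc.1 kc.2).
Proof.
apply: inj_card_bij; last by rewrite card_prod !card_ord size_flat_word.
by move=> [k c] [k' c'] /= /flat_pos_inj[-> ->].
Qed.

Lemma nth_flat_wb x k : (k < size x)%N ->
  nth White (flat_word wb x) (k * 2) = White /\
  nth White (flat_word wb x) (k * 2 + 1) = Black.
Proof.
elim: x k => // c x IH [|k]; first by case: c.
by move=> kx; have := IH k kx; case: c {kx}.
Qed.

Lemma big_pairs (A : pzRingType) (F : nat -> A) n :
  \prod_(l < (n * 2)%N) F l = \prod_(k < n) (F (k * 2)%N * F (k * 2 + 1)%N).
Proof.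
elim: n => [|n IH]; first by rewrite !big_ord0.
by rewrite [RHS]big_ord_recr /= -IH mulSnr addn2 !big_ord_recr /= -mulrA addn1.
Qed.

(* The flattening of a white letter lists the two copies of the levels in the order
   0, 1, that of a black letter in the order 1, 0. *)
Definition pair_white (A : pzRingType) (I J : Type) (Mo Mb : fmx A I J) :
    fmx A (I * I) (J * J) := fun a b => Mo a.1 b.1 * Mb a.2 b.2.

Definition pair_black (A : pzRingType) (I J : Type) (Mo Mb : fmx A I J) :
    fmx A (I * I) (J * J) := fun a b => Mo a.2 b.2 * Mb a.1 b.1.

Section UnflatWords.
Variables (x : word).

(** The first component belongs to copy 0 of the levels, which at a black letter sits at the second
    of its two positions. *)
Definition unflat_ffun (I : finType) (pi : {ffun 'I_(size (flat_word wb x)) -> I}) :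
    {ffun 'I_(size x) -> I * I} :=
  [ffun k => (pi (@flat_pos wb x k ord0), pi (@flat_pos wb x k ord_max))].

Lemma unflat_ffun_bij (I : finType) : bijective (@unflat_ffun I).
Proof.
have [g fK gK] := flat_pos_bij wb x.
exists (fun p : {ffun 'I_(size x) -> I * I} => [ffun j => let: kc := g j in
          if kc.2 == ord0 then (p kc.1).1 else (p kc.1).2]) => p.
  apply/ffunP => j; rewrite !ffunE -[in RHS](gK j); case: (g j) => k [[|[|//]] hc] /=.
    by rewrite (_ : Ordinal hc = ord0) //; exact: val_inj.
  by rewrite (_ : Ordinal hc = ord_max) //; exact: val_inj.
apply/ffunP => k; rewrite !ffunE (fK (k, ord0)) (fK (k, ord_max)) /=.
by case: (p k).
Qed.

(** Letter [k] of [x] owns the positions 2k and 2k + 1, coloured white and black whatever the letter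
    is; its colour decides only which copy sits where. The order of factors is unchanged, so [A] may
    be noncommutative. *)
Lemma fmx_word_flat (A : pzRingType) (I J : finType) (Mo Mb : fmx A I J) pi pi' :
  fmx_word Mo Mb (flat_word wb x) pi pi' =
  fmx_word (pair_white Mo Mb) (pair_black Mo Mb) x (unflat_ffun pi) (unflat_ffun pi').
Proof.
rewrite /fmx_word.
pose G (l : 'I_(size (flat_word wb x))) : A :=
  (match letter l with White => Mo | Black => Mb end) (pi l) (pi' l).
(* Extending the factors to all of nat, by 1 outside the word, lets them be paired
   arithmetically. *)
pose F (j : nat) : A := if insub j is Some l then G l else 1.
have FG (l : 'I_(size (flat_word wb x))) : F l = G l by rewrite /F valK.
under eq_bigr => l _ do rewrite -/(G l) -FG.
have -> : \prod_(l < size (flat_word wb x)) F l =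
    \prod_(k < size x) (F (k * 2)%N * F (k * 2 + 1)%N).
  by rewrite size_flat_word big_pairs.
apply: eq_bigr => k _; have [n0 n1] := nth_flat_wb (ltn_ord k).
case ek : (letter k).
  have -> : F (k * 2)%N = G (@flat_pos wb x k ord0).
    by rewrite -FG /= ek addn0.
  have -> : F (k * 2 + 1)%N = G (@flat_pos wb x k ord_max) by rewrite -FG /= ek.
  rewrite /G /letter !(tnth_nth White) /= -/(letter k) ek addn0 n0 n1 !ffunE.
  by [].
have -> : F (k * 2)%N = G (@flat_pos wb x k ord_max).
  by rewrite -FG /= ek addn0.
have -> : F (k * 2 + 1)%N = G (@flat_pos wb x k ord0) by rewrite -FG /= ek.
by rewrite /G /letter !(tnth_nth White) /= -/(letter k) ek addn0 n0 n1 !ffunE.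
Qed.

End UnflatWords.

(** * Multi-indices for the doubled grading *)

Section Indices.
Variables (m : nat) (n : 'I_m -> nat).
Local Notation n' := (flat_grading wb n).

(** The identification of the tensor square of the space graded by [n] with the space of the doubled
    grading, on basis indices. *)
Definition join_index (b : multi_index n * multi_index n) : multi_index n' :=
  [ffun l => if @lev_copy m wb l == ord0 then b.1 (@lev_base m wb l) else b.2 (@lev_base m wb l)].

Lemma join_index_bij : bijective join_index.
Proof.
(* The bounds at [k] and at [lev_base (lev k c)] agree only propositionally, hence the cast. *)
pose half (c : 'I_2) (a : multi_index n') : multi_index n :=
  [ffun k => cast_ord (congr1 n (@lev_base_lev m wb k c)) (a (@lev m wb k c))].
exists (fun a => (half ord0 a, half ord_max a)) => [[b1 b2]|a].
  by congr (_, _); apply/ffunP => k; apply: val_inj;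
    rewrite /= !ffunE /= (@lev_copy_lev m wb) /= (@lev_base_lev m wb).
apply/ffunP => l; apply: val_inj; rewrite /= ffunE /=.
have aE l1 l2 : l1 = l2 -> a l1 = a l2 :> nat by move=> ->.
have lK := @levK m wb l; case: eqP => [e|e]; rewrite ffunE /=; apply: aE.
  by rewrite -[RHS]lK e.
have e1 : @lev_copy m wb l = ord_max :> 'I_2.
  by case: (@lev_copy m wb l) e => -[|[|//]] hc e; apply: val_inj => //; case: e; exact: val_inj.
by rewrite -[RHS]lK e1.
Qed.

Definition join_ffun x (al : {ffun 'I_(size (flat_word wb x)) -> multi_index n}) :
    {ffun 'I_(size x) -> multi_index n'} :=
  [ffun k => join_index (unflat_ffun al k)].

Lemma join_ffun_bij x : bijective (@join_ffun x).
Proof.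
have [g fK gK] := @unflat_ffun_bij x (multi_index n).
have [h hK Kh] := join_index_bij.
exists (fun a : {ffun 'I_(size x) -> multi_index n'} => g [ffun k => h (a k)]) => a.
  rewrite -[RHS]fK; congr (g _); apply/ffunP => k.
  by rewrite !ffunE hK.
by apply/ffunP => k; rewrite ffunE gK ffunE Kh.
Qed.

(** Flattening merely regroups points, and the coefficient of [sp_map] is [const_on] of
    [point_label] by definition. *)
Lemma sp_map_flat (R : realType) x y (p : spart (m * size wb) x y) al be :
  sp_map R n' p (join_ffun al) (join_ffun be) = sp_map R n (sp_flat wb p) al be.
Proof.
suff E : const_on (blocks p) (point_label (join_ffun al) (join_ffun be)) =
    const_on (blocks (sp_flat wb p)) (point_label al be).
  exact: (congr1 (fun b : bool => (b%:R : R[i])) E).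
rewrite /sp_flat /= const_on_imset; apply: eq_const_on.
have E z (ga : {ffun 'I_(size (flat_word wb z)) -> multi_index n}) k l :
    join_ffun ga k l = ga (flat_pos k (lev_copy l)) (lev_base l) :> nat.
  rewrite /join_ffun ffunE /join_index ffunE /unflat_ffun ffunE /=.
  case: eqP => [->//|e].
  have -> : lev_copy l = ord_max :> 'I_2.
    by case: (lev_copy l) e => -[|[|//]] hc e; apply: val_inj => //; case: e; exact: val_inj.
  by [].
by case=> [[k|k] l]; rewrite /point_label /= E.
Qed.

End Indices.

Lemma sp_intertwinerE (R : realType) m (n : 'I_m -> nat) (I : finType)
    (Q : fmx R[i] I (multi_index n)) x y (p : spart m x y) :
  sp_intertwiner Q p = fmx_mul (fmx_word Q (cmx_conj Q) y)
    (fmx_mul (sp_map R n p) (cmx_adj (fmx_word Q (cmx_conj Q) x))).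
Proof. by rewrite cmx_adj_word. Qed.

Lemma in_span_map (R : realType) (I J I' J' : finType) (S : fmx R[i] I J -> Prop)
    (S' : fmx R[i] I' J' -> Prop) (P : fmx R[i] I' I) (N : fmx R[i] J J') T :
  (forall M, S M -> S' (fmx_mul P (fmx_mul M N))) ->
  in_span S T -> in_span S' (fmx_mul P (fmx_mul T N)).
Proof.
move=> SS' [k [c [M [SM TM]]]]; exists k, c, (fun l => fmx_mul P (fmx_mul (M l) N)).
split=> [l|i j]; first exact: SS'.
have -> : T = fun i j => \sum_l c l * M l i j by apply: fmxP.
rewrite /fmx_mul.
under eq_bigr => a _.
  under eq_bigr => b _ do rewrite big_distrl /=.
  rewrite exchange_big big_distrr /=; over.
rewrite exchange_big; apply: eq_bigr => l _; rewrite big_distrr; apply: eq_bigr => a _ /=.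
rewrite mulrCA; congr (_ * _); rewrite big_distrr; apply: eq_bigr => b _ /=.
by rewrite mulrA.
Qed.

(** * Hom spaces between flattened words *)

Section FlatIntertwiners.
Variables (R : realType) (m : nat) (n : 'I_m -> nat) (I : finType).
Variables (Q : fmx R[i] I (multi_index n)) (W : fmx R[i] (I * I)%type (I * I)%type).
Hypotheses (Qu : cmx_unitary Q) (Wu : cmx_unitary W).
Local Notation n' := (flat_grading wb n).

(** The unitary from the space of the flattened word to that of [x]: tensor factors are regrouped,
    then [W] acts at white letters and its conjugate at black ones. The conjugate is dictated by
    [sp_intertwiner], where [Q'] acts on black letters through [cmx_conj Q']. *)
Definition unflat_mx x :
    fmx R[i] {ffun 'I_(size x) -> I * I} {ffun 'I_(size (flat_word wb x)) -> I} :=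
  fun i pi => fmx_word W (cmx_conj W) x i (unflat_ffun pi).
Arguments unflat_mx : clear implicits.

Lemma unflat_mx_unitary x : cmx_unitary (unflat_mx x).
Proof.
apply: cmx_unitary_reindex; first exact: unflat_ffun_bij.
by apply: cmx_unitary_word => //; exact: cmx_unitary_conj.
Qed.

Variable Q' : fmx R[i] (I * I)%type (multi_index n').
Hypothesis Q'E : forall i b,
  Q' i (join_index b) = fmx_mul W (cmx_tensor Q (cmx_conj Q)) i b.

Lemma fmx_word_join x i al :
  fmx_word Q' (cmx_conj Q') x i (join_ffun al) =
  fmx_mul (unflat_mx x) (fmx_word Q (cmx_conj Q) (flat_word wb x)) i al.
Proof.
have -> : fmx_word Q' (cmx_conj Q') x i (join_ffun al) =
    fmx_word (fmx_mul W (cmx_tensor Q (cmx_conj Q)))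
      (cmx_conj (fmx_mul W (cmx_tensor Q (cmx_conj Q)))) x i (unflat_ffun al).
  by apply: eq_bigr => k _; case: letter; rewrite /cmx_conj ffunE Q'E.
rewrite cmx_conj_mul fmx_word_mul (fmx_mul_reindex _ _ (@unflat_ffun_bij x I)).
apply: eq_bigr => k _; congr (_ * _); rewrite fmx_word_flat.
(* At a black letter the conjugate of Q (x) conj Q is conj Q (x) Q, which is [pair_black] of Q and
   its conjugate. *)
apply: eq_bigr => l _; case: letter => //.
rewrite /cmx_tensor /pair_black /cmx_conj rmorphM mulrC; congr (_ * _); exact: conjCK.
Qed.

Lemma sp_intertwiner_join x y (p : spart (m * size wb) x y) :
  sp_intertwiner Q' p =
  fmx_mul (unflat_mx y)
    (fmx_mul (sp_intertwiner Q (sp_flat wb p)) (cmx_adj (unflat_mx x))).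
Proof.
rewrite !sp_intertwinerE.
rewrite (fmx_mul_reindex _ _ (@join_ffun_bij m n y)).
have -> : (fun i al => fmx_word Q' (cmx_conj Q') y i (join_ffun al)) =
    fmx_mul (unflat_mx y) (fmx_word Q (cmx_conj Q) (flat_word wb y)).
  by apply: fmxP => i al; exact: fmx_word_join.
rewrite (fmx_mul_reindex _ _ (@join_ffun_bij m n x)).
have -> : (fun al j => fmx_mul (fun a be => sp_map R n' p a (join_ffun be))
      (fun be j => cmx_adj (fmx_word Q' (cmx_conj Q') x) (join_ffun be) j) (join_ffun al) j) =
    fmx_mul (sp_map R n (sp_flat wb p))
      (cmx_adj (fmx_mul (unflat_mx x) (fmx_word Q (cmx_conj Q) (flat_word wb x)))).
  apply: fmxP => al j; apply: eq_bigr => be _; rewrite sp_map_flat; congr (_ * _).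
  by rewrite /cmx_adj fmx_word_join.
by rewrite cmx_adj_mul -!fmx_mulA.
Qed.

Variables (A : cstarAlg R) (u ub : fmx A I I) (u' ub' : fmx A (I * I)%type (I * I)%type).
Hypotheses (uW : intertwiner (pair_white u ub) u' W).
Hypotheses (ubW : intertwiner (pair_black u ub) ub' (cmx_conj W)).

Lemma unflat_mx_intertwiner x :
  intertwiner (fmx_word u ub (flat_word wb x)) (fmx_word u' ub' x) (unflat_mx x).
Proof.
move=> j i; have := intertwiner_word (x := x) uW ubW j (unflat_ffun i).
rewrite (reindex (@unflat_ffun x I)); last exact/onW_bij/unflat_ffun_bij.
by move=> <-; apply: eq_bigr => k _; rewrite fmx_word_flat.
Qed.

Lemma intertwiner_flat (C : spart_family m) :
  (forall x y T, intertwiner (fmx_word u ub x) (fmx_word u ub y) T <->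
     in_span (fun T' => exists2 p : spart m x y, C x y p & T' = sp_intertwiner Q p) T) ->
  forall x y T, intertwiner (fmx_word u' ub' x) (fmx_word u' ub' y) T <->
     in_span (fun T' => exists2 p : spart (m * size wb) x y,
       flat_preimage wb C x y p & T' = sp_intertwiner Q' p) T.
Proof.
move=> CE x y T; have [x1 x2] := (cmx_unitaryE _).1 (unflat_mx_unitary x).
have [y1 y2] := (cmx_unitaryE _).1 (unflat_mx_unitary y).
pose L := unflat_mx; pose S := fmx_mul (cmx_adj (L y)) (fmx_mul T (L x)).
have TS : T = fmx_mul (L y) (fmx_mul S (cmx_adj (L x))).
  by rewrite /S -!fmx_mulA x1 fmx_mul1r fmx_mulA y1 fmx_mul1l.
transitivity (intertwiner (fmx_word u ub (flat_word wb x)) (fmx_word u ub (flat_word wb y)) S).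
  have hx := @unflat_mx_intertwiner x; have hy := @unflat_mx_intertwiner y.
  have hx' := intertwiner_adj (unflat_mx_unitary x) hx.
  have hy' := intertwiner_adj (unflat_mx_unitary y) hy.
  split=> [hT|hS]; first exact: intertwiner_comp (intertwiner_comp hx hT) hy'.
  by rewrite TS; exact: intertwiner_comp (intertwiner_comp hx' hS) hy.
rewrite CE; split=> [hS|hT].
  rewrite TS; apply: in_span_map hS => _ [q Cq ->].
  (* Every element of [C] between the flattened words is itself a flattening. *)
  have [p pE] := @sp_flat_surj m wb x y q; exists p; first by rewrite /flat_preimage pE.
  by rewrite sp_intertwiner_join pE.
apply: in_span_map hT => _ [p Cp ->]; exists (sp_flat wb p) => //.
by rewrite sp_intertwiner_join -!fmx_mulA x2 fmx_mul1r fmx_mulA y2 fmx_mul1l.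
Qed.

End FlatIntertwiners.

(** * The cup compares [ub] with the conjugate of [u] *)

Section Conjugator.
Variables (R : realType) (m : nat) (n : 'I_m -> nat).
Variables (r : spart m [::] [:: White; Black]) (s : spart m [::] [:: Black; White]).
Hypotheses (rg : sp_graded n r) (sg : sp_graded n s).
Hypotheses (rs : snake r s = sp_id m [:: White]) (sr : snake s r = sp_id m [:: Black]).

Definition index_rel x (p : spart m [::] x) : rel (multi_index n) :=
  fun a b => rel2 p (fun l => a l) (fun l => b l).

Lemma index_rel_snake c c' (p : spart m [::] [:: c; c']) (q : spart m [::] [:: c'; c]) :
  sp_graded n p -> sp_graded n q -> snake p q = sp_id m [:: c] ->
  forall a b : multi_index n,
    (exists2 h, index_rel p a h & index_rel q h b) <-> a = b.
Proof.
move=> pg qg pq a b.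
have E := snake_rel pg qg pq (fun l => ltn_ord (a l)) (fun l => ltn_ord (b l)).
split=> [[h ah hb]|->].
  apply/ffunP => l; apply: val_inj; move: l; apply/E.
  by exists (fun l => h l : nat); split=> // l; exact: ltn_ord.
have [h [hh ph qh]] := (snake_rel pg qg pq (fun l => ltn_ord (b l)) (fun l => ltn_ord (b l))).2
  (frefl _).
exists ([ffun l => Ordinal (hh l)] : multi_index n).
  by rewrite /index_rel (eq_rel2 p (a' := fun l => b l) (b' := h)) // => l; rewrite ffunE.
by rewrite /index_rel (eq_rel2 q (a' := h) (b' := fun l => b l)) // => l; rewrite ffunE.
Qed.

Definition cup_mx : fmx R[i] (multi_index n) (multi_index n) :=
  fun a b => (index_rel r a b)%:R.

Lemma cup_mx_unitary : cmx_unitary cup_mx.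
Proof.
by apply: (@inverse_relations_unitary R _ _ (index_rel s)); exact: index_rel_snake.
Qed.

Definition pair_ffun (X : finType) (p : X * X) : {ffun 'I_2 -> X} :=
  [ffun k => if k == ord0 then p.1 else p.2].

Lemma pair_ffun_bij (X : finType) : bijective (@pair_ffun X).
Proof.
exists (fun f : {ffun 'I_2 -> X} => (f ord0, f ord_max)) => [[a b]|f].
  by rewrite /pair_ffun !ffunE.
apply/ffunP => -[[|[|//]] hc]; rewrite ffunE /=; first by congr (f _); exact: val_inj.
by congr (f _); exact: val_inj.
Qed.

Lemma fmx_word_pair (A : pzRingType) (X Y : finType) (Mo Mb : fmx A X Y) p q :
  fmx_word Mo Mb wb (pair_ffun p) (pair_ffun q) = Mo p.1 q.1 * Mb p.2 q.2.
Proof. by rewrite /fmx_word !big_ord_recl big_ord0 /= !ffunE mulr1. Qed.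

Variables (I : finType) (Q : fmx R[i] I (multi_index n)).
Hypothesis Qu : cmx_unitary Q.

Definition cup_vector : fmx R[i] I I := fmx_mul Q (fmx_mul cup_mx (cmx_adj Q)).

Lemma ffun_nil_eq (X : finType) (f g : {ffun 'I_(size ([::] : word)) -> X}) : f = g.
Proof. by apply/ffunP => -[]. Qed.

(** The conjugate of [Q] on the black leg is the adjoint of [Q] with indices exchanged, so the
    vector of the cup becomes the matrix Q T_r Q^*. *)
Lemma sp_intertwiner_cup i j :
  sp_intertwiner Q r (pair_ffun i) j = cup_vector i.1 i.2.
Proof.
rewrite /sp_intertwiner /cup_vector.
rewrite (fmx_mul_reindex _ _ (@pair_ffun_bij (multi_index n))) /fmx_mul.
rewrite -(pair_bigA _ (fun a b => fmx_word Q (cmx_conj Q) wb (pair_ffun i) (pair_ffun (a, b)) *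
  \sum_k sp_map R n r (pair_ffun (a, b)) k * fmx_word _ _ [::] k j)) /=.
apply: eq_bigr => a _; rewrite big_distrr; apply: eq_bigr => b _ /=.
rewrite fmx_word_pair /= -mulrA; congr (_ * _); rewrite mulrC.
pose k0 : {ffun 'I_(size ([::] : word)) -> multi_index n} := [ffun => a].
rewrite (bigD1 k0) //= big1 => [|k]; last by rewrite (ffun_nil_eq k k0) eqxx.
rewrite addr0 /fmx_word big_ord0 mulr1; congr (_ * _).
suff -> : sp_map R n r (pair_ffun (a, b)) k0 = (index_rel r a b)%:R by [].
have E : const_on (blocks r) (@point_label m n [::] wb (pair_ffun (a, b)) k0) = index_rel r a b.
  apply: eq_const_on => -[[[]//|k] l]; rewrite /lab /point_label /= ffunE.
  by case: k => -[|[|]].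
exact: (congr1 (fun b : bool => (b%:R : R[i])) E).
Qed.

Variables (A : cstarAlg R) (u ub : fmx A I I).
Hypothesis uu : amx_unitary u.
Hypothesis cup_fixed :
  intertwiner (fmx_word u ub [::]) (fmx_word u ub wb) (sp_intertwiner Q r).

(** This is the entrywise conjugate of [cup_vector], written as the adjoint of the transpose: the
    fixed vector yields an intertwiner for the transpose, and [intertwiner_adj] reverses it. *)
Definition conjugator : fmx R[i] I I := cmx_adj (fun i j => cup_vector j i).

Lemma cup_vector_unitary : cmx_unitary cup_vector.
Proof.
apply: cmx_unitary_mul => //; apply: cmx_unitary_mul; first exact: cup_mx_unitary.
exact: cmx_unitary_adj.
Qed.

Lemma conjugator_unitary : cmx_unitary conjugator.
Proof.
apply: cmx_unitary_adj; have [c1 c2] := cup_vector_unitary.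
have oneC (i j : I) : fmx_one R[i] i j = fmx_one _ j i by rewrite /fmx_one eq_sym.
by split=> i j; rewrite oneC; [rewrite -c2|rewrite -c1]; apply: eq_bigr => k _; rewrite mulrC.
Qed.

(** With c for [cup_vector], invariance of the cup says that c = u Y, where Y is c times the
    transpose of [ub]. Unitarity of [u] gives Y = u^* c, which read in transposed position says that
    the transpose of c intertwines conj u with [ub]. *)
Lemma conjugator_intertwiner : intertwiner ub (amx_conj u) conjugator.
Proof.
apply: intertwiner_adj.
  by have := cmx_unitary_adj conjugator_unitary; rewrite /conjugator cmx_adjK.
pose Y : fmx A I I := fun k j => \sum_l cup_vector k l *: ub j l.
have fixE : emb A cup_vector = fmx_mul u Y.
  apply: fmxP => i j.
  have k0 : {ffun 'I_(size ([::] : word)) -> I} := [ffun => i].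
  have := cup_fixed (pair_ffun (i, j)) k0.
  rewrite (bigD1 k0) //= big1 => [|k]; last by rewrite (ffun_nil_eq k k0) eqxx.
  rewrite addr0 sp_intertwiner_cup /fmx_word big_ord0 /= -/(emb A cup_vector i j) => ->.
  rewrite (reindex (@pair_ffun I)); last exact/onW_bij/pair_ffun_bij.
  rewrite -(pair_bigA _ (fun k l => sp_intertwiner Q r (pair_ffun (k, l)) k0 *:
    fmx_word u ub wb (pair_ffun (i, j)) (pair_ffun (k, l)))) /=.
  apply: eq_bigr => k _; rewrite big_distrr; apply: eq_bigr => l _ /=.
  by rewrite sp_intertwiner_cup fmx_word_pair /= scalerAr.
have [_ /fmxP u2] := uu.
have YE : Y = fmx_mul (amx_adj u) (emb A cup_vector).
  by rewrite fixE fmx_mulA u2 fmx_mul1l.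
move=> j i; rewrite -/(Y i j) YE; apply: eq_bigr => k _.
by rewrite /emb mulr_algr.
Qed.

End Conjugator.

Section IntertwinerTensor.
Variables (R : realType) (A : cstarAlg R) (I J K L : finType).

Lemma intertwiner_one (v : fmx A I I) : intertwiner v v (@fmx_one R[i] I).
Proof. by apply/intertwinerE; rewrite emb_one fmx_mul1l fmx_mul1r. Qed.

Lemma intertwiner_tensor (v : fmx A I I) (w : fmx A J J) (v' : fmx A K K) (w' : fmx A L L) S T :
  intertwiner v w S -> intertwiner v' w' T ->
  intertwiner (amx_tensor v v') (amx_tensor w w') (cmx_tensor S T).
Proof.
move=> hS hT j i.
have split2 (X Y : finType) (a : X -> R[i]) (b : Y -> R[i]) (f : X -> A) (g : Y -> A) :
    \sum_(k : X * Y) (a k.1 * b k.2) *: (f k.1 * g k.2) =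
    (\sum_k a k *: f k) * (\sum_k b k *: g k).
  rewrite big_distrlr pair_big; apply: eq_bigr => k _ /=.
  by rewrite -scalerAl -scalerAr scalerA.
rewrite /cmx_tensor /amx_tensor (split2 I K (S j.1) (T j.2) (v^~ i.1) (v'^~ i.2)).
by rewrite (split2 J L (S^~ i.1) (T^~ i.2) (w j.1) (w' j.2)) hS hT.
Qed.

End IntertwinerTensor.

(** * Matrices over a C*-subalgebra *)

Section SubMatrices.
Variables (R : realType) (A : cstarAlg R) (S : set A).
Implicit Types (I J : finType).
Local Notation B := (cstar_sub_cstar S).

Lemma sub_val_sum I (F : I -> B) :
  val (\sum_i F i : cstar_sub S) = \sum_i val (F i : cstar_sub S).
Proof. exact: (raddf_sum (val : cstar_sub S -> A)). Qed.

Definition sub_mx_val I J (v : fmx B I J) : fmx A I J := fun i j => val (v i j : cstar_sub S).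

Lemma sub_mx_unitary I (v : fmx B I I) : amx_unitary (sub_mx_val v) -> amx_unitary v.
Proof.
have oneE i j : val (fmx_one B i j : cstar_sub S) = @fmx_one A I i j.
  by rewrite /fmx_one; case: eqP.
by move=> [v1 v2]; split=> i j; apply: val_inj; rewrite oneE; [rewrite -v1|rewrite -v2];
  exact: sub_val_sum.
Qed.

Lemma sub_mx_word I (vo vb : fmx B I I) x :
  sub_mx_val (fmx_word vo vb x) = fmx_word (sub_mx_val vo) (sub_mx_val vb) x.
Proof.
apply: fmxP => i j; rewrite /sub_mx_val /fmx_word.
rewrite [LHS](rmorph_prod (val : cstar_sub S -> A)); apply: eq_bigr => k _.
by case: letter.
Qed.

(** The inclusion is linear and injective; thus Hom spaces of PG may be computed over C(G). *)
Lemma sub_mx_intertwiner I J (v : fmx B I I) (w : fmx B J J) T :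
  intertwiner v w T <-> intertwiner (sub_mx_val v) (sub_mx_val w) T.
Proof.
have vE j i : val (\sum_k T j k *: v k i : cstar_sub S) = \sum_k T j k *: sub_mx_val v k i.
  exact: sub_val_sum.
have wE j i : val (\sum_k T k i *: w j k : cstar_sub S) = \sum_k T k i *: sub_mx_val w j k.
  exact: sub_val_sum.
split=> h j i; first by rewrite -vE -wE h.
by apply: val_inj; rewrite vE wE h.
Qed.

End SubMatrices.

(** * The projective version *)

Section Main.
Variables (R : realType) (m : nat) (n : 'I_m -> nat) (C : spart_family m) (G : cmqg_data R).

Lemma swap_bij (X : Type) : bijective (fun p : X * X => (p.2, p.1)).
Proof. by exists (fun p : X * X => (p.2, p.1)) => -[]. Qed.

Lemma projective_corresponds :
  corresponds_to G n C ->
  corresponds_to (projective_version G) (flat_grading wb n) (flat_preimage wb C).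
Proof.
move=> [m0 Ccat Crig Cgr [D [[_ uu _ uc] [ub [Q [[ubu ubc] Qu CE]]]]]].
have [r [s [Cr Cs rs sr]]] := Crig.
set u := qfund G in uu uc CE; set S := @proj_entries R G.
have pc : is_corep D (proj_fund G) by apply: is_corep_tensor => //; exact: is_corep_star.
(* The fundamental matrix of PG is a corepresentation, so [D] of an entry is a sum of elementary
   tensors of entries. *)
have DS a : S a -> cstar_gen ([set b | exists a a' : cstar_sub S,
    b = comult_tens D (val a) (val a')])%classic (D a).
  move=> [i [j ->]]; rewrite pc; apply: cstar_gen_sum => k; apply: cstar_gen_sub.
  by exists (Sub (proj_fund G i k) (proj_fundP i k)), (Sub (proj_fund G k j) (proj_fundP k j)).
pose D' : comult (qalg (projective_version G)) := sub_comult DS.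
pose W := cmx_tensor (@fmx_one R[i] (qdim G)) (conjugator r Q).
have rg := Cgr _ _ _ Cr; have sg := Cgr _ _ _ Cs.
have Eu : cmx_unitary (conjugator r Q) by exact: conjugator_unitary rg sg rs sr _ _ Qu.
have oneu : cmx_unitary (@fmx_one R[i] (qdim G)).
  have h : cmx_adj (@fmx_one R[i] (qdim G)) = @fmx_one _ _.
    by apply: fmxP => i j; rewrite /cmx_adj fmx_one_conj /fmx_one eq_sym.
  by apply/cmx_unitaryE; rewrite h fmx_mul1l.
have Wu : cmx_unitary W by exact: cmx_unitary_tensor.
have cup : intertwiner (fmx_word u ub [::]) (fmx_word u ub wb) (sp_intertwiner Q r).
  apply/CE; exists 1%N, (fun=> 1), (fun=> sp_intertwiner Q r).
  by split=> [_|i j]; [exists r|rewrite big_ord_recl big_ord0 addr0 mul1r].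
have Ei : intertwiner ub (amx_conj u) (conjugator r Q).
  exact: conjugator_intertwiner rg sg rs sr _ _ Qu _ _ _ uu cup.
have uW : intertwiner (pair_white u ub) (proj_fund G) W.
  by apply: intertwiner_tensor => //; exact: intertwiner_one.
have pwu : amx_unitary (pair_white u ub) by exact: amx_unitary_tensor.
(* Unitarity is transported from u (x) ub, which is unitary by hypothesis on both factors. *)
have pu : amx_unitary (proj_fund G).
  by rewrite (intertwiner_conjugate Wu uW); exact: amx_conjugate_unitary.
(* The flip of u (x) ub is conjugated by conj W, not by W, in accordance with the action of [Q'] on
   black letters. *)
pose ub' := amx_conjugate (cmx_conj W) (pair_black u ub).
have Wcu : cmx_unitary (cmx_conj W) by exact: cmx_unitary_conj.
have ub'u : amx_unitary ub'.
  by apply: amx_conjugate_unitary => //; exact: amx_unitary_reindex (swap_bij _) pwu.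
have ub'c : is_corep D ub'.
  apply: is_corep_conjugate => //.
  exact: (is_corep_reindex (swap_bij (qdim G)) (is_corep_tensor uc ubc)).
have ubW : intertwiner (pair_black u ub) ub' (cmx_conj W).
  exact: amx_conjugate_intertwiner.
(* Conjugating back by the adjoint of W expresses the entries of u (x) ub through those of PG; those
   of its flip, and then of [ub'], follow. *)
have pwg i j : cstar_gen S (pair_white u ub i j).
  rewrite (intertwiner_conjugate (cmx_unitary_adj Wu) (intertwiner_adj Wu uW)).
  by apply: amx_conjugate_gen => k l; have := proj_fundP k l; rewrite inE.
have ub'g : forall i j, cstar_gen S (ub' i j).
  by apply: amx_conjugate_gen => i j; exact: (pwg (i.2, i.1) (j.2, j.1)).
pose ubS : fmx (cstar_sub_cstar S) _ _ := fun i j => to_sub (ub'g i j).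
have pSu : amx_unitary (qfund (projective_version G)) by exact: sub_mx_unitary.
split.
- by rewrite muln_gt0 m0.
- exact: flat_preimage_category.
- exact: flat_preimage_rigid.
- by move=> x y p /Cgr; exact: sp_graded_flat.
exists D'; split.
  split.
  - rewrite -[RHS](@cstar_sub_gen R _ S); congr cstar_gen; apply/seteqP; split=> a /=.
      by move=> [i [j ->]]; exists i, j.
    by move=> [i [j e]]; exists i, j; apply: val_inj; exact: e.
  - exact: pSu.
  (* The star reverses products, so the entrywise adjoint of u (x) conj u is its flip, whose inverse
     is the adjoint. *)
  - have swapE : amx_conj (qfund (projective_version G)) =
        fun i j => qfund (projective_version G) (i.2, i.1) (j.2, j.1).
      by apply: fmxP => i j; apply: val_inj; rewrite /= /proj_fund /amx_tensor starM starK.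
    have swu := amx_unitary_reindex (swap_bij (qdim G)) pSu.
    by exists (amx_adj (amx_conj (qfund (projective_version G)))); rewrite swapE; case: swu.
  - exact: sub_comult_corep.
have [h hK Kh] := join_index_bij n.
(* [Q'] is this unitary read on doubled multi-indices, through the inverse [h] of [join_index]. *)
pose V := fmx_mul W (cmx_tensor Q (cmx_conj Q)).
pose Q' : fmx R[i] (qdim G * qdim G)%type (multi_index (flat_grading wb n)) :=
  fun i a => V i (h a).
exists ubS, Q'; split.
- by split; [exact: sub_mx_unitary|exact: sub_comult_corep].
- apply: cmx_unitary_reindex; first by exists (@join_index m n).
  by apply: cmx_unitary_mul => //; apply: cmx_unitary_tensor => //; exact: cmx_unitary_conj.
move=> x y T.
have Q'E i b : Q' i (join_index b) = V i b by rewrite /Q' hK.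
have := intertwiner_flat Wu Q'E uW ubW CE T.
rewrite sub_mx_intertwiner !sub_mx_word; exact.
Qed.

End Main.

Theorem theorem2 (R : realType) (m : nat) (n : 'I_m -> nat)
    (C : spart_family m) (G : cmqg_data R) (hG : corresponds_to G n C) :
  is_spatial_partition_qg (projective_version G) /\
  corresponds_to (projective_version G)
    (flat_grading [:: White; Black] n) (flat_preimage [:: White; Black] C).
Proof.
by split; [do 3 eexists|]; exact: projective_corresponds hG.
Qed.
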